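(* Let $p\ge2$ be an integer and let $f\colon\mathbb{R}^d\to\mathbb{R}$ be a continuously differentiable convex function with unique minimizer $x^*$. The continuous-time limit (as the step size $\epsilon\to0$) of the algorithm $x_{k+1}=G_{p,\epsilon,1}(x_k)$ is the rescaled gradient flow $$\dot X_t=-\frac{\nabla f(X_t)}{\|\nabla f(X_t)\|_*^{\frac{p-2}{p-1}}},$$ where the right-hand side is defined to be zero if $\nabla f(X_t)=0$. Furthermore, the rescaled gradient flow has convergence rate $$f(X_t)-f(x^* )\le\frac{(p-1)^{p-1}R^p}{t^{p-1}}=O\Big(\frac1{t^{p-1}}\Big),$$ where $R=\sup_{x\colon f(x)\le f(X_0)}\|x-x^*\|$ is the radius of the level set of $f$ from the initial point $X_0$.
   Context: $\|\cdot\|$ is the inner product norm $\|x\|=\langle x,x\rangle^{1/2}$ on $\mathbb{R}^d$ and $\|\cdot\|_*$ is its dual norm. The $(p-1)$-st order Taylor approximation of $f$ at $x$ is $f_{p-1}(y;x)=\sum_{i=0}^{p-1}\frac1{i!}\nabla^if(x)(y-x)^i$ (so the algorithm presupposes that these derivatives exist). For a step size $\epsilon>0$, the update operator of the $p$-th order gradient algorithm, with its regularization constant taken to be $1$, is $$G_{p,\epsilon,1}(x)=\arg\min_{y}\Big\{f_{p-1}(y;x)+\frac{1}{\epsilon p}\|y-x\|^p\Big\}.$$ In the continuous-time limit the discrete sequence $x_k$ is viewed as a discretization $x_k=X_t$, $x_{k+1}=X_{t+\delta}\approx X_t+\delta\dot X_t$ of a curve $X_t$, with $t=\delta k$ and time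 step $\delta=\epsilon^{\frac1{p-1}}$, and $\epsilon\to0$. *)

(* Defs.v *)
From HB Require Import structures.
From mathcomp Require Import all_boot all_order all_algebra.
From mathcomp Require Import all_classical all_reals all_analysis.

Set Implicit Arguments.
Unset Strict Implicit.
Unset Printing Implicit Defensive.

Import Order.TTheory GRing.Theory Num.Theory.
Import numFieldNormedType.Exports.

Local Open Scope classical_set_scope.
Local Open Scope ring_scope.

(* The library norm on ['rV[R]_d] is the sup norm; the Euclidean structure is
   therefore introduced separately.  Both induce the same topology. *)
Definition dotv (R : realType) (d : nat) (u v : 'rV[R]_d) : R :=
  \sum_(i < d) u 0 i * v 0 i.

Definition enorm (R : realType) (d : nat) (u : 'rV[R]_d) : R :=
  Num.sqrt (dotv u u).

Definition dual_norm (R : realType) (d : nat) (s : 'rV[R]_d) : R :=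
  sup [set dotv s u | u in [set u | enorm u <= 1]].

(* [nabla f [:: v1; ...; vk] x] is the value of the k-linear form
   [nabla^k f(x)] on [(v1, ..., vk)]. *)
Fixpoint nabla (R : realType) (d : nat) (f : 'rV[R]_d -> R)
    (vs : seq 'rV[R]_d) : 'rV[R]_d -> R :=
  if vs is v :: vs' then 'D_v (nabla f vs' : 'rV[R]_d -> R^o) else f.

(* In finite dimension, Frechet differentiability of the tensor-valued map
   [nabla^i f] is differentiability of all its values on fixed vectors. *)
Definition times_differentiable (R : realType) (d k : nat)
    (f : 'rV[R]_d -> R) : Prop :=
  forall vs x, (size vs < k)%N ->
    differentiable (nabla f vs : 'rV[R]_d -> R^o) x.

Definition times_continuously_differentiable (R : realType) (d k : nat)
    (f : 'rV[R]_d -> R) : Prop :=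
  times_differentiable k f /\
  forall vs, size vs = k -> continuous (nabla f vs).

Definition grad (R : realType) (d : nat) (f : 'rV[R]_d -> R)
    (x : 'rV[R]_d) : 'rV[R]_d :=
  \row_(i < d) nabla f [:: delta_mx 0 i] x.

Definition unique_minimizer (R : realType) (d : nat) (f : 'rV[R]_d -> R)
    (xstar : 'rV[R]_d) : Prop :=
  (forall x, f xstar <= f x) /\
  (forall x, (forall z, f x <= f z) -> x = xstar).

(* [taylor n f x y] is the n-th order Taylor approximation [f_n(y; x)]. *)
Definition taylor (R : realType) (d n : nat) (f : 'rV[R]_d -> R)
    (x y : 'rV[R]_d) : R :=
  \sum_(i < n.+1) (i`!%:R)^-1 * nabla f (nseq i (y - x)) x.

(* The argmin is a set: the regularized Taylor polynomial need not be convex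
   for p >= 4, so its minimizer may fail to be unique. *)
Definition gradient_update (R : realType) (d p : nat) (eps : R)
    (f : 'rV[R]_d -> R) (x : 'rV[R]_d) : set 'rV[R]_d :=
  let obj y := taylor (p - 1) f x y + (eps * p%:R)^-1 * enorm (y - x) ^+ p in
  [set y | forall z, obj y <= obj z].

Definition gradient_algorithm (R : realType) (d p : nat) (eps : R)
    (f : 'rV[R]_d -> R) (x0 : 'rV[R]_d) (x : nat -> 'rV[R]_d) : Prop :=
  x 0%N = x0 /\ forall k, gradient_update p eps f (x k) (x k.+1).

Definition time_step (R : realType) (p : nat) (eps : R) : R :=
  eps `^ ((p - 1)%:R^-1).

Definition rescaled_field (R : realType) (d p : nat) (f : 'rV[R]_d -> R)
    (x : 'rV[R]_d) : 'rV[R]_d :=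
  if grad f x == 0 then 0
  else - ((dual_norm (grad f x) `^ ((p - 2)%:R / (p - 1)%:R))^-1 *: grad f x).

(* Only the values of [X] on [0, +oo[ matter.  The equation is required for
   t > 0; with continuity at 0 it then also holds for the right derivative at
   0, the field being continuous when f is continuously differentiable. *)
Definition rescaled_gradient_flow (R : realType) (d p : nat)
    (f : 'rV[R]_d -> R) (x0 : 'rV[R]_d) (X : R -> 'rV[R]_d) : Prop :=
  [/\ X 0 = x0,
      {within `[0, +oo[, continuous X} &
      forall t : R, 0 < t -> is_derive t 1 X (rescaled_field p f (X t))].

(* Every family of runs of the algorithm, indexed by the step size eps,
   satisfies [x_k = X (delta k) + o(1)] as eps -> 0, uniformly over bounded
   time intervals. *)
Definition continuous_time_limit (R : realType) (d p : nat)
    (f : 'rV[R]_d -> R) (x0 : 'rV[R]_d) (X : R -> 'rV[R]_d) : Prop :=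
  forall x : R -> nat -> 'rV[R]_d,
    (forall eps, 0 < eps -> gradient_algorithm p eps f x0 (x eps)) ->
  forall T eta : R, 0 < eta ->
  \forall eps \near (0 : R)^'+, forall k : nat,
    time_step p eps * k%:R <= T ->
    enorm (x eps k - X (time_step p eps * k%:R)) < eta.

(* The sublevel sets of a convex function on R^d with a unique minimizer are
   bounded, so in that case [sup] is a genuine supremum. *)
Definition level_radius (R : realType) (d : nat) (f : 'rV[R]_d -> R)
    (xstar x0 : 'rV[R]_d) : R :=
  sup [set enorm (x - xstar) | x in [set x | f x <= f x0]].

(* Main.v *)
(* Velocity: after the substitution y = x + delta u the objective becomes, up to
   an additive constant, delta times <grad f(x), u> + |u|^p / p + O(delta).  The
   limit functional has the unique minimizer F(x), the rescaled gradient field,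
   and uniform convexity of |u|^p makes u tend to F(x), uniformly for x in a
   bounded set on which the derivatives of f are bounded.

   Convergence: the runs are thus consistent with F, and f increases by at most
   o(delta) per step, so they stay in a sublevel set, which is compact.  Along any
   ultrafilter finer than eps -> 0+ they converge locally uniformly to a
   solution of the flow; Euler's scheme gives existence in the same way.  Since
   the flow is unique, every ultrafilter gives the same limit.

   Uniqueness: once a solution reaches the minimizer it stays there, because f
   decreases along the flow.  Elsewhere F satisfies a one-sided Lipschitz
   estimate: for p = 2 by monotonicity of grad f, for p >= 3 because f is C^2.

   Rate: for the radius r of the level set, t^p (f(X t) - min f) -
   (p-1)^(p-1) r^p t is nonincreasing. *)
Require Import Defs.
From HB Require Import structures.
From mathcomp Require Import all_boot all_order all_algebra.
From mathcomp Require Import all_classical all_reals all_analysis.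
From mathcomp Require Import ring lra.

Set Implicit Arguments.
Unset Strict Implicit.
Unset Printing Implicit Defensive.

Import Order.TTheory GRing.Theory Num.Theory.
Import numFieldNormedType.Exports.

Local Open Scope classical_set_scope.
Local Open Scope ring_scope.

(** * Euclidean structure of row vectors *)

Section Euclidean.
Variables (R : realType) (d : nat).
Implicit Types (u v w : 'rV[R]_d) (a : R).

Lemma dotvC u v : dotv u v = dotv v u.
Proof. by apply: eq_bigr => i _; rewrite mulrC. Qed.

Lemma dotvDl u v w : dotv (u + v) w = dotv u w + dotv v w.
Proof.
by rewrite /dotv -big_split; apply: eq_bigr => i _; rewrite mxE mulrDl.
Qed.

Lemma dotvZl a u v : dotv (a *: u) v = a * dotv u v.
Proof. by rewrite mulr_sumr; apply: eq_bigr => i _; rewrite mxE mulrA. Qed.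

Lemma dotvNl u v : dotv (- u) v = - dotv u v.
Proof. by rewrite -scaleN1r dotvZl mulN1r. Qed.

Lemma dotvBl u v w : dotv (u - v) w = dotv u w - dotv v w.
Proof. by rewrite dotvDl dotvNl. Qed.

Lemma dotvDr u v w : dotv w (u + v) = dotv w u + dotv w v.
Proof. by rewrite !(dotvC w) dotvDl. Qed.

Lemma dotvZr a u v : dotv u (a *: v) = a * dotv u v.
Proof. by rewrite !(dotvC u) dotvZl. Qed.

Lemma dotvNr u v : dotv u (- v) = - dotv u v.
Proof. by rewrite !(dotvC u) dotvNl. Qed.

Lemma dotvBr u v w : dotv w (u - v) = dotv w u - dotv w v.
Proof. by rewrite !(dotvC w) dotvBl. Qed.

Lemma dotv0l u : dotv 0 u = 0.
Proof. by rewrite -(scale0r 0) dotvZl mul0r. Qed.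

Lemma dotv0r u : dotv u 0 = 0.
Proof. by rewrite dotvC dotv0l. Qed.

Lemma dotvv_ge0 u : 0 <= dotv u u.
Proof. by apply: sumr_ge0 => i _; rewrite -expr2 sqr_ge0. Qed.

Lemma enorm_ge0 u : 0 <= enorm u.
Proof. exact: sqrtr_ge0. Qed.

Lemma sqr_enorm u : enorm u ^+ 2 = dotv u u.
Proof. exact/sqr_sqrtr/dotvv_ge0. Qed.

Lemma dotvv_eq0 u : dotv u u = 0 -> u = 0.
Proof.
move=> /eqP; rewrite psumr_eq0 => [/allP u0|i _]; last by rewrite -expr2 sqr_ge0.
apply/rowP => i; rewrite mxE.
by have /implyP /(_ isT) := u0 i (mem_index_enum i); rewrite mulf_eq0 orbb => /eqP.
Qed.

Lemma enorm_eq0 u : (enorm u == 0) = (u == 0).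
Proof.
apply/eqP/eqP => [u0|->]; last by rewrite /enorm dotv0l sqrtr0.
by apply: dotvv_eq0; rewrite -sqr_enorm u0 expr0n.
Qed.

Lemma enorm0 : enorm (0 : 'rV[R]_d) = 0.
Proof. by apply/eqP; rewrite enorm_eq0. Qed.

Lemma enorm_gt0 u : (0 < enorm u) = (u != 0).
Proof. by rewrite lt_def enorm_ge0 andbT enorm_eq0. Qed.

Lemma enormZ a u : enorm (a *: u) = `|a| * enorm u.
Proof.
by rewrite /enorm dotvZl dotvZr mulrA -expr2 sqrtrM ?sqr_ge0// sqrtr_sqr.
Qed.

Lemma enormN u : enorm (- u) = enorm u.
Proof. by rewrite -scaleN1r enormZ normrN1 mul1r. Qed.

Lemma enormB u v : enorm (u - v) = enorm (v - u).
Proof. by rewrite -enormN opprB. Qed.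

Lemma dotv_le u v : dotv u v <= enorm u * enorm v.
Proof.
have [->|u0] := eqVneq u 0; first by rewrite dotv0l mulr_ge0 ?enorm_ge0.
have [->|v0] := eqVneq v 0; first by rewrite dotv0r mulr_ge0 ?enorm_ge0.
(* The squared norm of this vector is [2 * a * b * (a * b - c)] with [a = enorm u], [b = enorm v],
   [c = dotv u v]; dividing by [a * b > 0] gives Cauchy-Schwarz. *)
have := dotvv_ge0 (enorm v *: u - enorm u *: v).
rewrite dotvBl !dotvBr !dotvZl !dotvZr -!sqr_enorm (dotvC v u).
move: u0 v0; rewrite -!enorm_gt0 => a0 b0.
set a := enorm u in a0 *; set b := enorm v in b0 *; set c := dotv u v.
have ab0 : 0 < a * b by rewrite mulr_gt0.
move=> H; rewrite -(ler_pM2l ab0); nra.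
Qed.

Lemma normr_dotv_le u v : `|dotv u v| <= enorm u * enorm v.
Proof.
by rewrite ler_norml dotv_le andbT lerNl -dotvNl (le_trans (dotv_le _ _))// enormN.
Qed.

Lemma enormD u v : enorm (u + v) <= enorm u + enorm v.
Proof.
rewrite -(@ler_pXn2r _ 2%N)// ?nnegrE ?addr_ge0 ?enorm_ge0// sqr_enorm.
rewrite dotvDl !dotvDr -!sqr_enorm (dotvC v u).
have := dotv_le u v; nra.
Qed.

Lemma enorm_dist u v w : enorm (u - w) <= enorm (u - v) + enorm (v - w).
Proof. by rewrite -{1}(subrKA v) enormD. Qed.

Lemma enorm_subl u v : enorm u - enorm v <= enorm (u - v).
Proof. by rewrite lerBlDr -{1}(subrK v u) enormD. Qed.

Lemma enorm_sum (I : Type) (r : seq I) (P : pred I) (F : I -> 'rV[R]_d) :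
  enorm (\sum_(i <- r | P i) F i) <= \sum_(i <- r | P i) enorm (F i).
Proof.
elim/big_ind2: _ => [|u a v b ua vb|//]; first by rewrite enorm0.
by rewrite (le_trans (enormD _ _))// lerD.
Qed.

Lemma normr_coord_le u i : `|u 0 i| <= enorm u.
Proof.
rewrite -(@ler_pXn2r _ 2%N)// ?nnegrE ?enorm_ge0// sqr_enorm real_normK ?num_real//.
rewrite /dotv (bigD1 i)//= -expr2 lerDl.
by apply: sumr_ge0 => j _; rewrite -expr2 sqr_ge0.
Qed.

Lemma enorm_delta_mx i : enorm (delta_mx 0 i : 'rV[R]_d) = 1.
Proof.
rewrite /enorm /dotv (bigD1 i)//= big1 => [|j ji].
  by rewrite !mxE !eqxx mulr1 addr0 sqrtr1.
by rewrite !mxE (negbTE ji) andbF mul0r.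
Qed.

Lemma normr_le_enorm u : `|u| <= enorm u.
Proof.
rewrite [leLHS]/Num.norm/= mx_normrE.
by apply: bigmax_le => [|[i j] _]; rewrite ?enorm_ge0 //= ord1 normr_coord_le.
Qed.

Lemma enorm_le_normr u : enorm u <= d%:R * `|u|.
Proof.
rewrite {1}(row_sum_delta u) (le_trans (enorm_sum _ _ _))//.
rewrite mulr_natl -[leRHS]/(`|u| *+ d) -[X in _ *+ X]card_ord -sumr_const.
apply: ler_sum => i _; rewrite enormZ enorm_delta_mx mulr1.
rewrite [leRHS]/Num.norm/= mx_normrE.
exact: (le_bigmax _ (fun ij => `|u ij.1 ij.2|) (0, i)).
Qed.

(** Passage from the sup-norm topology to Euclidean balls, through the two comparisons
    [normr_le_enorm] and [enorm_le_normr]. *)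
Lemma enorm_near (x : 'rV[R]_d) (P : set 'rV[R]_d) :
  nbhs x P <-> exists2 e, 0 < e & forall y, enorm (y - x) < e -> P y.
Proof.
split=> [/nbhs_ballP[e /= e0 eP]|[e e0 eP]].
  exists e => // y yx; apply: eP; rewrite -ball_normE /= distrC.
  exact: le_lt_trans (normr_le_enorm _) yx.
(* The denominator [d.+1] instead of [d] keeps the radius positive in dimension 0. *)
apply/nbhs_ballP; exists (e / d.+1%:R); first by rewrite /= divr_gt0.
move=> y; rewrite -ball_normE /= distrC ltr_pdivlMr// => yx; apply: eP.
rewrite (le_lt_trans (enorm_le_normr _))// (le_lt_trans _ yx)// mulrC.
by rewrite ler_wpM2l// ler_nat.
Qed.

Lemma cvg_enormP (T : Type) (F : set_system T) {FF : Filter F}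
    (g : T -> 'rV[R]_d) (l : 'rV[R]_d) :
  g @ F --> l <-> forall e, 0 < e -> \forall t \near F, enorm (g t - l) < e.
Proof.
split=> [gl e e0|gl P /enorm_near[e e0 eP]].
  have /gl : nbhs l [set y | enorm (y - l) < e] by apply/enorm_near; exists e.
  by [].
by apply: filterS (gl e e0) => t /eP.
Qed.

Lemma cvg_at_enormP (T : topologicalType) (g : T -> 'rV[R]_d) (x : T)
    (l : 'rV[R]_d) :
  g @ x --> l <-> forall e, 0 < e -> \forall y \near x, enorm (g y - l) < e.
Proof. exact: (@cvg_enormP _ (nbhs x)). Qed.

Lemma enorm_continuous : continuous (@enorm R d).
Proof.
move=> x; apply/(@cvgrPdist_lt _ _ _ (nbhs x)) => e e0.
apply/enorm_near; exists e => // y yx.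
have := enorm_subl x y; have := enorm_subl y x.
by rewrite [enorm (x - y)]enormB ltr_norml => h1 h2; apply/andP; split; lra.
Qed.

Lemma enorm_dist_continuous (x : 'rV[R]_d) :
  continuous (fun y : 'rV[R]_d => enorm (y - x)).
Proof.
move=> y.
apply: (@continuous_comp _ _ _ (fun y : 'rV[R]_d => y - x) (@enorm R d)).
  apply: (@continuousB _ _ _ id (cst x)) => //; exact: cst_continuous.
exact: enorm_continuous.
Qed.

Lemma closed_ball_compact (x : 'rV[R]_d) r :
  compact [set y | enorm (y - x) <= r].
Proof.
apply: bounded_closed_compact.
  exists (r + enorm x); split => [|M rM y /= yr]; first exact: num_real.
  rewrite (le_trans (normr_le_enorm _))// (le_trans _ (ltW rM))// -lerBlDr.
  exact: le_trans (enorm_subl _ _) yr.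
apply: (@closed_comp _ _ (fun y : 'rV[R]_d => enorm (y - x)) [set t | t <= r]).
  by move=> y _; exact: enorm_dist_continuous.
exact: closed_le.
Qed.

(** Cauchy-Schwarz bounds the supremum, and the unit vector along [u] attains it; [u = 0] cannot be
    normalized and is treated apart. *)
Lemma dual_norm_enorm u : dual_norm u = enorm u.
Proof.
apply/eqP; rewrite eq_le; apply/andP; split.
  apply: sup_le_ub; first by exists 0, 0 => /=; rewrite ?enorm0 ?dotv0r.
  move=> _ [v /= v1 <-]; rewrite (le_trans (dotv_le _ _))//.
  by rewrite ler_piMr ?enorm_ge0.
have [->|u0] := eqVneq u 0.
  by rewrite enorm0; apply: ub_le_sup; [exists 0 => _ [v _ <-]; rewrite dotv0l
    |exists 0 => /=; rewrite ?enorm0 ?dotv0l].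
apply: ub_le_sup.
  exists (enorm u) => _ [v /= v1 <-]; rewrite (le_trans (dotv_le _ _))//.
  by rewrite ler_piMr ?enorm_ge0.
have n0 : enorm u != 0 by rewrite enorm_eq0.
exists ((enorm u)^-1 *: u) => /=.
  by rewrite enormZ ger0_norm ?invr_ge0 ?enorm_ge0// mulVf.
by rewrite dotvZr -sqr_enorm expr2 mulKf.
Qed.

End Euclidean.

(** * Uniform convexity of powers of the norm *)

Section PowerInequalities.
Variable R : realFieldType.
Implicit Types (a b c t w : R) (n : nat).

Let natrS1 n : n.+1%:R = n%:R + 1 :> R. Proof. by rewrite natr1. Qed.

(** The graph of [c |-> c ^+ n.+1] lies above its tangent at [t]. The induction adds the square term
    [H] to [c] times the hypothesis. *)
Lemma tangent_power_le t c n : 0 <= t -> 0 <= c ->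
  n.+1%:R * (t ^+ n * c) <= n%:R * t ^+ n.+1 + c ^+ n.+1.
Proof.
move=> t0 c0; elim: n => [|n IH]; first by rewrite !expr1 expr0; lra.
have H : 0 <= n.+1%:R * t ^+ n * (t - c) ^+ 2.
  by rewrite mulr_ge0 ?sqr_ge0// mulr_ge0 ?exprn_ge0.
have := ler_wpM2l c0 IH; move: H.
rewrite !exprS (natrS1 n) (natrS1 n.+1) (natrS1 n).
set s := t ^+ n; set r := c ^+ n; set m := n%:R; nra.
Qed.

(** Young's inequality with weights [2 / (n + 2)] and [n / (n + 2)]. In the induction step the two
    factors of [H] have the same sign. *)
Lemma young_sqr_power a b n : 0 <= a -> 0 <= b ->
  n.+2%:R * (a ^+ 2 * b ^+ n) <= 2 * a ^+ n.+2 + n%:R * b ^+ n.+2.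
Proof.
move=> a0 b0; elim: n => [|n IH]; first by rewrite expr0; lra.
have H : 0 <= (a - b) * (2 * a ^+ n.+2 - b ^+ n.+1 * a - b ^+ n.+2).
  have [ab|/ltW ab] := leP b a.
    rewrite mulr_ge0 ?subr_ge0//.
    have := lerXn2r n.+2 b0 a0 ab.
    have := ler_wpM2r a0 (lerXn2r n.+1 b0 a0 ab).
    by rewrite -exprSr; lra.
  rewrite mulr_le0 ?subr_le0//.
  have := lerXn2r n.+2 a0 b0 ab.
  have := ler_wpM2r a0 (lerXn2r n.+1 a0 b0 ab).
  by rewrite -exprSr; lra.
have := ler_wpM2l b0 IH; move: H.
rewrite !exprS (natrS1 n.+2) (natrS1 n.+1) (natrS1 n).
set s := a ^+ n; set r := b ^+ n; set m := n%:R; nra.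
Qed.

Lemma natr_le_exp3 n : 3 * n.+2%:R <= 2 * 3 ^+ n.+1 :> R.
Proof.
elim: n => [|n IH]; first by rewrite expr1; lra.
have H : 0 <= n%:R :> R by [].
by move: IH; rewrite !exprS (natrS1 n.+2) (natrS1 n.+1) (natrS1 n); lra.
Qed.

(* [(a ^+ 2 + b ^+ 2 - w ^+ 2) / 2] is the inner product of two vectors of
   norms [a] and [b] at distance [w]. *)
Lemma power_bregman_ge a b w n : 0 <= a -> 0 <= b -> 0 <= w ->
    w <= a + b -> a - b <= w -> b - a <= w ->
  (w / 4) ^+ n.+2 / (3 * n.+2%:R) <=
    a ^+ n.+2 / n.+2%:R + n.+1%:R / n.+2%:R * b ^+ n.+2
    - b ^+ n * ((a ^+ 2 + b ^+ 2 - w ^+ 2) / 2).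
Proof.
move=> a0 b0 w0 wab abw baw.
have n0 : 0 < n.+2%:R :> R by [].
have n0' : n.+2%:R != 0 :> R by [].
have m0 : 0 <= n%:R :> R by [].
have b'0 := exprn_ge0 n b0.
(* If [w <= 4 * b], Young's inequality cancels everything except a multiple of [b ^+ n * w ^+ 2],
   which dominates the left side. Otherwise [a > 3 * b], and [a ^+ n.+2] absorbs the mixed term with
   room to spare. *)
have [wb|wb] := leP w (4 * b).
  have H1 : (w / 4) ^+ n.+2 <= b ^+ n * (w ^+ 2 / 16).
    have -> : (w / 4) ^+ n.+2 = (w / 4) ^+ n * (w ^+ 2 / 16).
      have -> : w ^+ 2 / 16 = (w / 4) ^+ 2 by field.
      by rewrite -exprD addn2.
    by rewrite ler_wpM2r ?divr_ge0 ?sqr_ge0// lerXn2r ?nnegrE ?divr_ge0//; lra.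
  have H2 := young_sqr_power n a0 b0.
  rewrite -(ler_pM2l n0).
  rewrite (_ : n.+2%:R * ((w / 4) ^+ n.+2 / (3 * n.+2%:R)) = (w / 4) ^+ n.+2 / 3);
    last by field.
  rewrite (_ : n.+2%:R * (_ + _ - _) = a ^+ n.+2 + n.+1%:R * b ^+ n.+2
    - n.+2%:R * (b ^+ n * ((a ^+ 2 + b ^+ 2 - w ^+ 2) / 2))); last by field.
  have H3 : 0 <= n%:R * (b ^+ n * w ^+ 2) by rewrite !mulr_ge0 ?sqr_ge0.
  have H4 : 0 <= b ^+ n * w ^+ 2 by rewrite mulr_ge0 ?sqr_ge0.
  have H5 : b ^+ n.+2 = b ^+ n * b ^+ 2 by rewrite -exprD addn2.
  move: H1 H2 H3 H4; rewrite H5 (natrS1 n.+1) (natrS1 n).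
  set s := b ^+ n; set q := a ^+ n.+2; set m := n%:R; set W := w ^+ 2; lra.
have H1 : (w / 4) ^+ n.+2 <= a ^+ n.+2 by rewrite lerXn2r ?nnegrE ?divr_ge0//; lra.
have H2 : b ^+ n.+1 * a * 3 ^+ n.+1 <= a ^+ n.+2.
  rewrite [leRHS]exprSr mulrAC ler_wpM2r// -exprMn lerXn2r ?nnegrE ?mulr_ge0//; lra.
have H3 := natr_le_exp3 n.
have H4 : b ^+ n * ((a ^+ 2 + b ^+ 2 - w ^+ 2) / 2) <= b ^+ n.+1 * a.
  by rewrite [b ^+ n.+1]exprSr -mulrA ler_wpM2l//; nra.
have H5 : 0 <= b ^+ n.+1 * a by rewrite mulr_ge0 ?exprn_ge0.
have H6 : b ^+ n.+1 * a * (3 * n.+2%:R) <= 2 * a ^+ n.+2.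
  have := ler_wpM2l H5 H3; lra.
have H7 : 0 <= n.+1%:R / n.+2%:R * b ^+ n.+2 by rewrite mulr_ge0 ?exprn_ge0 ?divr_ge0.
apply: (@le_trans _ _ (a ^+ n.+2 / n.+2%:R - b ^+ n.+1 * a)).
  rewrite ler_pdivrMr ?mulr_gt0// mulrBl.
  rewrite (_ : a ^+ n.+2 / n.+2%:R * (3 * n.+2%:R) = 3 * a ^+ n.+2); last by field.
  lra.
by rewrite -addrA lerD2l -[leLHS]add0r lerD// lerN2.
Qed.

End PowerInequalities.

(** * Bregman divergence of the power of the norm, and the inverse of the power map *)

Section Bregman.
Variables (R : realType) (d : nat).
Implicit Types (u v : 'rV[R]_d).

(* The Bregman divergence of [x |-> enorm x ^+ p / p]. *)
Lemma enorm_bregman_ge n u v :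
  (enorm (u - v) / 4) ^+ n.+2 / (3 * n.+2%:R) <=
    enorm u ^+ n.+2 / n.+2%:R + n.+1%:R / n.+2%:R * enorm v ^+ n.+2
    - enorm v ^+ n * dotv v u.
Proof.
have -> : dotv v u = (enorm u ^+ 2 + enorm v ^+ 2 - enorm (u - v) ^+ 2) / 2.
  by rewrite !sqr_enorm dotvBl !dotvBr (dotvC u v); field.
apply: power_bregman_ge; rewrite ?enorm_ge0//.
- by rewrite (le_trans (enormD _ _))// enormN.
- exact: enorm_subl.
- by rewrite enormB enorm_subl.
Qed.

(** Sum of the Bregman inequality for [(u, v)] and the one for [(v, u)]. *)
Lemma enorm_power_monotone n u v :
  2 * ((enorm (u - v) / 4) ^+ n.+2 / (3 * n.+2%:R)) <=
    dotv (enorm u ^+ n *: u - enorm v ^+ n *: v) (u - v).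
Proof.
have E (a : R) : a ^+ n * a ^+ 2 = a ^+ n.+2 by rewrite -exprD addn2.
have e1 (a : R) : a / n.+2%:R + n.+1%:R / n.+2%:R * a = a.
  rewrite [_ / _ * a]mulrAC -mulrDl -{1}(mul1r a) -mulrDl [1 + _]addrC natr1.
  by rewrite mulrAC mulfV// mul1r.
have := enorm_bregman_ge n u v; have := enorm_bregman_ge n v u.
have := e1 (enorm u ^+ n.+2); have := e1 (enorm v ^+ n.+2).
rewrite [enorm (v - u)]enormB dotvBl !dotvBr !dotvZl -!sqr_enorm !E (dotvC u v).
move: (_ / (3 * _)) => A.
move: (enorm v ^+ n.+2 / _) (enorm u ^+ n.+2 / _) => V U.
move: (_ / _ * enorm v ^+ _) (_ / _ * enorm u ^+ _) => V' U'.
move: (enorm v ^+ n.+2) (enorm u ^+ n.+2) (_ ^+ n * _) (_ ^+ n * _) => *.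
lra.
Qed.

(** The inverse of [u |-> enorm u ^+ n *: u] is Hölder continuous of exponent [1 / (n + 1)]:
    Cauchy-Schwarz bounds the monotonicity pairing, and one factor [enorm (u - v)] cancels. *)
Lemma power_map_root_holder n u v (a b : 'rV[R]_d) :
  enorm u ^+ n *: u = a -> enorm v ^+ n *: v = b ->
  (enorm (u - v) / 4) ^+ n.+1 <= 6 * n.+2%:R * enorm (a - b).
Proof.
move=> <- <-; have := enorm_power_monotone n u v.
move=> /le_trans /(_ (dotv_le _ _)).
set w := enorm (u - v); set G := enorm (_ - _) => H.
have G0 : 0 <= G := enorm_ge0 _.
have [w0|w0] := eqVneq w 0.
  by rewrite w0 mul0r expr0n/= !mulr_ge0.
have {}w0 : 0 < w by rewrite lt_def w0 enorm_ge0.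
rewrite -(ler_pM2l w0).
have n0' : 0 <= 6 * n.+2%:R :> R by rewrite mulr_ge0.
have := ler_wpM2l n0' H; rewrite [(w / 4) ^+ n.+2]exprS.
set s := _ ^+ n.+1.
rewrite (_ : 6 * _ * (2 * _) = w * s); last by field; rewrite gt_eqF.
lra.
Qed.

End Bregman.

(** * The rescaled gradient field *)

Section Gradient.
Variables (R : realType) (d : nat).
Implicit Types (f g : 'rV[R]_d -> R) (x y u v : 'rV[R]_d).

Lemma enorm_le_sum u : enorm u <= \sum_(i < d) `|u 0 i|.
Proof.
rewrite {1}(row_sum_delta u) (le_trans (enorm_sum _ _ _))//.
by apply: ler_sum => i _; rewrite enormZ enorm_delta_mx mulr1.
Qed.

Lemma continuous_rV (h : 'rV[R]_d -> 'rV[R]_d) :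
  (forall i, continuous (fun x => h x 0 i)) -> continuous h.
Proof.
move=> hc x; apply/cvg_at_enormP => e e0.
have e'0 : 0 < e / d.+1%:R by rewrite divr_gt0.
have : \forall y \near x, forall i, `|h x 0 i - h y 0 i| < e / d.+1%:R.
  apply: (@filter_forall _ _
    (fun i y => `|h x 0 i - h y 0 i| < e / d.+1%:R) (nbhs x) _) => i.
  by have /(@cvgrPdist_lt _ _ _ (nbhs x)) := hc i x; apply.
apply: filterS => y hy.
rewrite (le_lt_trans (enorm_le_sum _))//.
apply: (@le_lt_trans _ _ (\sum_(i < d) e / d.+1%:R)).
  by apply: ler_sum => i _; rewrite !mxE distrC ltW.
rewrite sumr_const card_ord -mulrnAr -[X in e * X]mulr_natl mulrA.
by rewrite ltr_pdivrMr// ltr_pM2l// ltr_nat.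
Qed.

Lemma derive_sum_delta g x v : differentiable (g : _ -> R^o) x ->
  'D_v (g : _ -> R^o) x =
    \sum_(i < d) v 0 i * 'D_(delta_mx 0 i) (g : _ -> R^o) x.
Proof.
move=> dg; rewrite !deriveE// {1}(row_sum_delta v) linear_sum.
by apply: eq_bigr => i _; rewrite linearZ deriveE.
Qed.

Lemma derive_dotv_grad f x v : differentiable (f : _ -> R^o) x ->
  'D_v (f : _ -> R^o) x = dotv (grad f x) v.
Proof.
move=> df; rewrite derive_sum_delta//.
by apply: eq_bigr => i _; rewrite mxE mulrC.
Qed.

Lemma continuous_grad f :
  times_continuously_differentiable 1 f -> continuous (grad f).
Proof.
move=> [_ fc]; apply: continuous_rV => i.
have -> : (fun x => grad f x 0 i) = nabla f [:: delta_mx 0 i].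
  by apply/funext => x; rewrite mxE.
exact: fc.
Qed.

End Gradient.

(** * The field as the inverse power map applied to minus the gradient *)

Section RescaledField.
Variables (R : realType) (d n : nat) (f : 'rV[R]_d -> R).
Local Notation F := (rescaled_field n.+2 f).
Implicit Types x y : 'rV[R]_d.

(** The second equation is the stationarity condition of [v |-> dotv (grad f x) v + enorm v ^+ n.+2
    / n.+2%:R]. It holds at critical points too, so the properties of [F] are drawn from it without
    a case distinction. *)
Lemma enorm_rescaled_field x : enorm (F x) ^+ n.+1 = enorm (grad f x) /\
  enorm (F x) ^+ n *: F x = - grad f x.
Proof.
rewrite /rescaled_field; case: eqVneq => [->|g0].
  by rewrite enorm0 expr0n scaler0 oppr0.
(* The root [m] of order [n + 1] of the gradient norm is the norm of [F x]. *)
set g := grad f x in g0 *; set m := enorm g `^ n.+1%:R^-1.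
have m0 : 0 < m by rewrite powR_gt0// enorm_gt0.
have mn : m ^+ n.+1 = enorm g.
  by rewrite -powR_mulrn ?powR_ge0// -powRrM mulVf// powRr1 ?enorm_ge0.
have -> : dual_norm g `^ ((n.+2 - 2)%:R / (n.+2 - 1)%:R) = m ^+ n.
  rewrite dual_norm_enorm -powR_mulrn ?powR_ge0// -powRrM subn1 subSS subSS subn0.
  by rewrite mulrC.
have nF : enorm (- ((m ^+ n)^-1 *: g)) = m.
  rewrite enormN enormZ ger0_norm ?invr_ge0 ?exprn_ge0 ?ltW// -mn exprS.
  by rewrite mulrC mulfK// expf_neq0// gt_eqF.
rewrite nF; split => //.
by rewrite scalerN scalerA mulfV ?scale1r// expf_neq0// gt_eqF.
Qed.

Lemma rescaled_field_eq0 x : (F x == 0) = (grad f x == 0).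
Proof.
rewrite -!enorm_eq0; have [<- _] := enorm_rescaled_field x.
by rewrite expf_eq0.
Qed.

Lemma dotv_grad_rescaled_field x :
  dotv (grad f x) (F x) = - enorm (F x) ^+ n.+2.
Proof.
have [_ H] := enorm_rescaled_field x.
by rewrite -[grad f x]opprK -H dotvNl dotvZl -sqr_enorm -exprD addn2.
Qed.

Lemma rescaled_field_holder x y :
  (enorm (F x - F y) / 4) ^+ n.+1 <=
    6 * n.+2%:R * enorm (grad f x - grad f y).
Proof.
have [_ Fx] := enorm_rescaled_field x; have [_ Fy] := enorm_rescaled_field y.
by have := power_map_root_holder Fx Fy; rewrite -opprD enormN.
Qed.

(** The Hölder bound is uniform, hence gives continuity even where the gradient vanishes and the
    quotient formula degenerates. *)
Lemma continuous_rescaled_field : continuous (grad f) -> continuous F.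
Proof.
move=> gc x; apply/cvg_at_enormP => e e0.
have c0 : 0 < 6 * n.+2%:R :> R by rewrite mulr_gt0.
have e'0 : 0 < (e / 4) ^+ n.+1 / (6 * n.+2%:R) by rewrite divr_gt0// exprn_gt0// divr_gt0.
have /cvg_at_enormP /(_ _ e'0) := gc x; apply: filterS => y yx.
have H := rescaled_field_holder y x.
have {H} : (enorm (F y - F x) / 4) ^+ n.+1 < (e / 4) ^+ n.+1.
  by rewrite (le_lt_trans H)// mulrC -ltr_pdivlMr.
rewrite ltr_pXn2r// ?nnegrE ?divr_ge0 ?enorm_ge0 ?ltW//.
by rewrite ltr_pM2r// invr_gt0.
Qed.

End RescaledField.

(** * One step of the algorithm *)

Section Nabla.
Variables (R : realType) (d : nat) (f : 'rV[R]_d -> R).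
Implicit Types (x y u v : 'rV[R]_d) (vs ws : seq 'rV[R]_d).

(** At a differentiable point the directional derivative is linear in its direction; induction on
    [vs] carries this expansion through the outer derivatives. *)
Lemma nabla_sum_delta k vs ws v x : times_differentiable k f ->
  (size vs + size ws < k)%N ->
  nabla f (vs ++ v :: ws) x =
    \sum_(i < d) v 0 i * nabla f (vs ++ delta_mx 0 i :: ws) x.
Proof.
move=> df; elim: vs x => [|w vs IH] x /= sz; first exact/derive_sum_delta/df.
have -> : nabla f (vs ++ v :: ws) =
    \sum_(i < d) (v 0 i *: (nabla f (vs ++ delta_mx 0 i :: ws) : _ -> R^o)).
  by apply/funext => y; rewrite fct_sumE IH// ltnW.
have dv i : derivable (nabla f (vs ++ delta_mx 0 i :: ws) : _ -> R^o) x w.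
  by apply/diff_derivable/df; rewrite size_cat/= addnS.
rewrite derive_sum => [|i]; last exact/derivableZ.
by apply: eq_bigr => i _; rewrite deriveZ.
Qed.

Lemma nabla_continuous k ws : times_continuously_differentiable k f ->
  (size ws <= k)%N -> continuous (nabla f ws).
Proof.
move=> [df cf]; rewrite leq_eqVlt => /orP[/eqP|] sz; first exact: cf.
by move=> x; have := differentiable_continuous (df _ x sz).
Qed.

(** Bounds along fixed directions become uniform in the directions: the last entry of [vs] is
    expanded in the standard basis, whose vectors join [ws], and the shorter list falls under the
    induction hypothesis. *)
Lemma nabla_bound k (A : set 'rV[R]_d) : times_differentiable k f ->
    (forall ws, (size ws <= k)%N ->
      exists C, forall x, A x -> `|nabla f ws x| <= C) ->
  forall m ws, (m + size ws <= k)%N ->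
    exists2 C, 0 <= C & forall x vs r, A x -> size vs = m ->
      {in vs, forall v, enorm v <= r} -> `|nabla f (vs ++ ws) x| <= C * r ^+ m.
Proof.
move=> df bd; elim=> [|m IH] ws sz.
  have [C AC] := bd ws sz; exists `|C| => // x vs r Ax /size0nil -> _.
  by rewrite expr0 mulr1 (le_trans (AC x Ax))// ler_norm.
have : forall i : 'I_d, exists C, 0 <= C /\ forall x vs r, A x -> size vs = m ->
    {in vs, forall v, enorm v <= r} ->
    `|nabla f (vs ++ delta_mx 0 i :: ws) x| <= C * r ^+ m.
  by move=> i; have [|C C0 HC] := IH (delta_mx 0 i :: ws);
    [rewrite /= addnS -addSn|exists C].
move=> /choice[C HC]; exists (\sum_i C i).
  by apply: sumr_ge0 => i _; have [] := HC i.
move=> x vs r Ax; case/lastP: vs => // vs v; rewrite size_rcons => -[sv] vr.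
rewrite cat_rcons (nabla_sum_delta _ _ df) ?sv//.
rewrite (le_trans (ler_norm_sum _ _ _))// mulr_suml; apply: ler_sum => i _.
have [C0 {}HC] := HC i.
rewrite normrM mulrC exprSr mulrA ler_pM//.
  by apply: HC => // u uvs; apply: vr; rewrite mem_rcons inE uvs orbT.
by rewrite (le_trans (normr_coord_le _ _))// vr// mem_rcons inE eqxx.
Qed.

Lemma continuous_bounded_on (A : set 'rV[R]_d) (g : 'rV[R]_d -> R) :
  compact A -> continuous g -> exists C, forall x, A x -> `|g x| <= C.
Proof.
move=> cA cg.
have /ex_strict_bound_gt0[C _ HC] : bounded_set (g @` A).
  exact/(@compact_bounded _ R^o)/continuous_compact/cA/continuous_subspaceT.
by exists C => x Ax; apply/ltW/HC; exists x.
Qed.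

Definition taylor_tail n x v : R :=
  \sum_(i < n) (i.+2`!%:R)^-1 * nabla f (nseq i.+2 v) x.

Lemma taylorE n x y : differentiable (f : _ -> R^o) x ->
  taylor n.+1 f x y = f x + dotv (grad f x) (y - x) + taylor_tail n x (y - x).
Proof.
move=> df; rewrite /taylor big_ord_recl big_ord_recl/= !invr1 !mul1r addrA.
by rewrite derive_dotv_grad.
Qed.

(** All terms have order at least 2, which yields [a ^+ 2] for [a <= 1], and order at most [n + 1],
    so their growth in [u] stays below that of the regularizer, of order [n + 2]. *)
Lemma taylor_tail_bound n (A : set 'rV[R]_d) : times_differentiable n.+1 f ->
    (forall ws, (size ws <= n.+1)%N ->
      exists C, forall x, A x -> `|nabla f ws x| <= C) ->
  exists2 K, 0 <= K & forall x a u, A x -> 0 <= a <= 1 ->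
    `|taylor_tail n x (a *: u)| <= K * a ^+ 2 * (1 + enorm u ^+ n.+2).
Proof.
move=> df bd.
have : forall i : 'I_n, exists C, 0 <= C /\ forall x v, A x ->
    `|nabla f (nseq i.+2 v) x| <= C * enorm v ^+ i.+2.
  move=> i; have [|C C0 HC] := nabla_bound df bd (m := i.+2) (ws := [::]).
    by rewrite addn0 !ltnS.
  exists C; split => // x v Ax; rewrite -[nseq _ _]cats0.
  by apply: HC; rewrite ?size_nseq// => w; rewrite mem_nseq => /andP[_ /eqP ->].
move=> /choice[C HC]; exists (\sum_i C i).
  by apply: sumr_ge0 => i _; have [] := HC i.
move=> x a u Ax /andP[a0 a1].
rewrite (le_trans (ler_norm_sum _ _ _))// !mulr_suml; apply: ler_sum => i _.
have [C0 {}HC] := HC i; rewrite normrM.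
rewrite -[leRHS]mul1r ler_pM// .
  by rewrite ger0_norm ?invr_ge0// invf_le1 ?ltr0n ?fact_gt0// ler1n fact_gt0.
rewrite (le_trans (HC _ _ Ax))// enormZ ger0_norm// exprMn -mulrA ler_wpM2l//.
rewrite ler_pM ?exprn_ge0 ?enorm_ge0//.
  by rewrite -[i.+2]addn2 exprD ler_piMl ?exprn_ge0// exprn_ile1.
have [u1|/ltW u1] := leP (enorm u) 1.
  rewrite (@le_trans _ _ 1)//; first by rewrite exprn_ile1// enorm_ge0.
  by rewrite lerDl exprn_ge0// enorm_ge0.
rewrite (@le_trans _ _ (enorm u ^+ n.+2))// ?lerDr//.
by rewrite ler_weXn2l// !ltnS ltnW.
Qed.

End Nabla.

(** * Local consistency of the argmin step with the rescaled field *)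

Section Consistency.
Variables (R : realType) (d n : nat).
Implicit Types (x y g u v w : 'rV[R]_d).

Lemma root_bound (a B : R) : 1 <= B -> a ^+ n.+1 <= B -> a <= B.
Proof.
move=> B1 aB; have [a1|/ltW a1] := leP a 1; first exact: le_trans B1.
by rewrite (le_trans _ aB)// exprS ler_peMr ?exprn_ege1// (le_trans ler01).
Qed.

(** Without [E] the functional is minimal at [v], and its excess at [u] is the Bregman divergence of
    [u] and [v]. Minimality of [u] bounds this excess by the values of [E] at [u] and [v], of size
    [O(a)] once both points are bounded; uniform convexity then controls [enorm (u - v)]. *)
Lemma perturbed_argmin (M K eta : R) : 0 <= M -> 0 <= K -> 0 < eta ->
  exists2 a0, 0 < a0 & forall a g v u (E : 'rV[R]_d -> R), 0 <= a <= a0 ->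
    enorm g <= M -> enorm v ^+ n *: v = - g ->
    (forall w, `|E w| <= a * K * (1 + enorm w ^+ n.+2)) ->
    (forall w, dotv g u + enorm u ^+ n.+2 / n.+2%:R + E u <=
               dotv g w + enorm w ^+ n.+2 / n.+2%:R + E w) ->
    enorm (u - v) <= eta.
Proof.
move=> M0 K0 eta0; have n0 : 0 < n.+2%:R :> R by [].
(* A priori bound for [u], from the comparison with [w = 0], and for [v]. *)
set B := 2 * n.+2%:R * M + 2.
have B1 : 1 <= B.
  have : 0 <= 2 * n.+2%:R * M by rewrite !mulr_ge0.
  rewrite /B; lra.
have B0 : 0 <= B by lra.
(* The lower bound of the Bregman divergence at distance [eta]. *)
set c := (eta / 4) ^+ n.+2 / (3 * n.+2%:R).
have c0 : 0 < c by apply: divr_gt0; [apply/exprn_gt0/divr_gt0|apply: mulr_gt0].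
set L := K * (2 + 2 * B ^+ n.+2) + 1.
have L0 : 0 < L.
  have : 0 <= K * (2 + 2 * B ^+ n.+2) by rewrite mulr_ge0// addr_ge0// mulr_ge0// exprn_ge0.
  by rewrite /L; set z := K * _; lra.
have K1 : 0 < 2 * n.+2%:R * (K + 1) by rewrite !mulr_gt0// ltr_wpDl.
(* The first term lets half of the regularizer absorb the growth of [E]; the second makes the total
   perturbation at [u] and [v] at most [c]. The summands 1 in [K + 1] and [L] keep the denominators
   positive when [K = 0]. *)
exists (Num.min (2 * n.+2%:R * (K + 1))^-1 (c / L)).
  by rewrite lt_min invr_gt0 K1 divr_gt0.
move=> a g v u E /andP[a0]; rewrite le_min => /andP[aK aL] gM vg HE min_u.
have aK' : a * K * (2 * n.+2%:R) <= 1.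
  move: aK; rewrite -[X in _ <= X]mul1r ler_pdivlMr// => aK.
  have : 0 <= a * (2 * n.+2%:R) by rewrite !mulr_ge0.
  rewrite (_ : a * (2 * n.+2%:R * (K + 1)) =
    a * K * (2 * n.+2%:R) + a * (2 * n.+2%:R)) in aK; last by ring.
  lra.
have aL' : a * L <= c by move: aL; rewrite ler_pdivlMr.
have uB : enorm u <= B.
  have [u1|/ltW u1] := leP (enorm u) 1; first exact: le_trans B1.
  apply: root_bound => //.
  have u0 : 0 < enorm u by apply: lt_le_trans u1.
  have := min_u 0; rewrite dotv0r enorm0 expr0n mul0r !add0r.
  have := HE u; have := HE 0; rewrite enorm0 expr0n addr0 mulr1.
  rewrite !ler_norml => /andP[_ E0] /andP[Eu _] H.
  have Hg : - (M * enorm u) <= dotv g u.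
    have := normr_dotv_le g u; rewrite ler_norml => /andP[Hg _].
    by rewrite (le_trans _ Hg)// lerN2 ler_wpM2r// ltW.
  have P0 : 0 <= enorm u ^+ n.+2 by rewrite exprn_ge0// ltW.
  have H1 := ler_wpM2r P0 aK'.
  rewrite -(ler_pM2r u0) -exprSr.
  have H2 : enorm u ^+ n.+2 / n.+2%:R * (2 * n.+2%:R) = 2 * enorm u ^+ n.+2 by field.
  have H3 : enorm u ^+ n.+2 / n.+2%:R <= M * enorm u + a * K * (2 + enorm u ^+ n.+2).
    by move: Eu E0 H Hg; set P := _ / _; lra.
  have n20 : 0 <= 2 * n.+2%:R :> R by rewrite mulr_ge0.
  have := ler_wpM2r n20 H3; rewrite H2 /B.
  move: H1 aK' u1; move: (enorm u) (enorm u ^+ n.+2) => q P H1 aK' u1.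
  have e1 : (M * q + a * K * (2 + P)) * (2 * n.+2%:R) =
      2 * n.+2%:R * M * q + 2 * (a * K * (2 * n.+2%:R)) + a * K * (2 * n.+2%:R) * P.
    by ring.
  rewrite e1; move: H1 aK'; move: (a * K * _) (2 * _ * M) => T C; nra.
have vB : enorm v <= B.
  apply: root_bound => //.
  have : enorm (enorm v ^+ n *: v) <= M by rewrite vg enormN.
  rewrite enormZ ger0_norm ?exprn_ge0 ?enorm_ge0// -exprSr => /le_trans; apply.
  rewrite /B; have : M * 1 <= M * (2 * n.+2%:R).
    by rewrite ler_wpM2l// -[1]/(1%:R) -natrM ler_nat.
  by rewrite mulr1; lra.
have := enorm_bregman_ge n u v; have := min_u v.
have -> : dotv g v = - enorm v ^+ n.+2.
  by rewrite -[g]opprK -vg dotvNl dotvZl -sqr_enorm -exprD addn2.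
have -> : dotv g u = - (enorm v ^+ n * dotv v u).
  by rewrite -[g]opprK -vg dotvNl dotvZl.
have -> : n.+1%:R / n.+2%:R * enorm v ^+ n.+2 =
    enorm v ^+ n.+2 - enorm v ^+ n.+2 / n.+2%:R.
  by rewrite -(natr1 (R := R)) ; field.
have uP : enorm u ^+ n.+2 <= B ^+ n.+2 by rewrite lerXn2r ?nnegrE ?enorm_ge0.
have vP : enorm v ^+ n.+2 <= B ^+ n.+2 by rewrite lerXn2r ?nnegrE ?enorm_ge0.
have aK0 : 0 <= a * K by rewrite mulr_ge0.
have := HE u; have := HE v; rewrite !ler_norml => /andP[_ Ev] /andP[Eu _] H1 H2.
have H3 : (enorm (u - v) / 4) ^+ n.+2 / (3 * n.+2%:R) <= c.
  apply: le_trans aL'; have := ler_wpM2l aK0 uP; have := ler_wpM2l aK0 vP.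
  move: H1 H2 Ev Eu; rewrite /L.
  move: (_ / (3 * _)) (enorm u ^+ n.+2 / _) (enorm v ^+ n.+2 / _) => X Y Z.
  move: (enorm u ^+ n.+2) (enorm v ^+ n.+2) (B ^+ _) (enorm v ^+ n * _) => *; lra.
move: H3; rewrite ler_pM2r ?invr_gt0 ?mulr_gt0// ler_pXn2r ?nnegrE//.
- by rewrite ler_pM2r ?invr_gt0.
- by rewrite divr_ge0 ?enorm_ge0.
- by rewrite divr_ge0 ?ltW.
Qed.

Lemma time_step_gt0 (eps : R) : 0 < eps -> 0 < time_step n.+2 eps.
Proof. exact: powR_gt0. Qed.

Lemma time_step_exp (eps : R) : 0 <= eps -> time_step n.+2 eps ^+ n.+1 = eps.
Proof.
move=> e0; rewrite /time_step subn1/= -powR_mulrn ?powR_ge0// -powRrM.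
by rewrite mulVf ?powRr1.
Qed.

Lemma cvg_time_step : time_step n.+2 eps @[eps --> (0 : R)^'+] --> (0 : R).
Proof. by apply: powR_cvg0; rewrite invr_gt0 subn1. Qed.

Lemma scale_cancel (a z g1 t1 p1 g2 t2 p2 : R) : 0 < a ->
  z + a * g1 + a * t1 + a * p1 <= z + a * g2 + a * t2 + a * p2 ->
  g1 + p1 + t1 <= g2 + p2 + t2.
Proof. by move=> a0 H; rewrite -(ler_pM2l a0); lra. Qed.

Lemma gradient_updateE (f : 'rV[R]_d -> R) eps x y :
  gradient_update n.+2 eps f x y -> forall z,
  taylor n.+1 f x y + (eps * n.+2%:R)^-1 * enorm (y - x) ^+ n.+2 <=
  taylor n.+1 f x z + (eps * n.+2%:R)^-1 * enorm (z - x) ^+ n.+2.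
Proof. by rewrite /gradient_update subn1. Qed.

Lemma gradient_update_consistent (f : 'rV[R]_d -> R) (A : set 'rV[R]_d) (eta : R) :
    times_differentiable n.+1 f ->
    (forall ws, (size ws <= n.+1)%N ->
      exists C, forall x, A x -> `|nabla f ws x| <= C) ->
    0 < eta ->
  \forall eps \near (0 : R)^'+, forall x y, A x -> gradient_update n.+2 eps f x y ->
    enorm (y - x - time_step n.+2 eps *: rescaled_field n.+2 f x)
      <= eta * time_step n.+2 eps.
Proof.
move=> df bd eta0.
have [K K0 HK] := taylor_tail_bound df bd.
have [M M0 HM] : exists2 M, 0 <= M & forall x, A x -> enorm (grad f x) <= M.
  have : forall i : 'I_d, exists C, forall x, A x -> `|nabla f [:: delta_mx 0 i] x| <= C.
    by move=> i; apply: bd.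
  move=> /choice[C HC]; exists (\sum_i `|C i|); first exact: sumr_ge0.
  move=> x Ax; rewrite (le_trans (enorm_le_sum _))//; apply: ler_sum => i _.
  by rewrite mxE (le_trans (HC i x Ax))// ler_norm.
have [a0 a00 Ha0] := perturbed_argmin M0 K0 eta0.
have Hdl : \forall eps \near (0 : R)^'+,
    `|0 - time_step n.+2 eps| < Num.min 1 a0.
  by have /cvgrPdist_lt := cvg_time_step; apply; rewrite lt_min ltr01.
near=> eps.
have eps0 : 0 < eps by near: eps; exact: nbhs_right_gt.
have : `|0 - time_step n.+2 eps| < Num.min 1 a0 by near: eps; exact: Hdl.
have := time_step_gt0 eps0; have := time_step_exp (ltW eps0).
move: (time_step n.+2 eps) => dl dlE dl0.
rewrite sub0r normrN gtr0_norm// lt_min => /andP[dl1 dla] x y Ax yx.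
have [u yu] : exists u, y - x = dl *: u.
  by exists (dl^-1 *: (y - x)); rewrite scalerA mulfV ?scale1r// gt_eqF.
rewrite yu -scalerBr enormZ gtr0_norm// mulrC ler_pM2r//.
have [_ HF] := enorm_rescaled_field n f x.
(* The objective in [u], divided by [dl], has the rescaled Taylor tail as perturbation; its
   quadratic bound becomes linear in [dl], which takes the place of [a]. *)
apply: (Ha0 dl _ _ _ (fun w => taylor_tail f n x (dl *: w) / dl) _ (HM _ Ax) HF).
- by rewrite !ltW.
- move=> w; rewrite normrM [`|dl^-1|]gtr0_norm ?invr_gt0// ler_pdivrMr//.
  have -> : dl * K * (1 + enorm w ^+ n.+2) * dl = K * dl ^+ 2 * (1 + enorm w ^+ n.+2).
    by ring.
  by apply: HK => //; rewrite !ltW.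
move=> w.
have dfx : differentiable (f : _ -> R^o) x by apply: (df [::]).
have := gradient_updateE yx (x + dl *: w).
have xw : x + dl *: w - x = dl *: w by rewrite addrAC subrr add0r.
rewrite (taylorE _ y dfx).
rewrite (taylorE _ (x + dl *: w) dfx).
rewrite xw yu.
rewrite !enormZ (gtr0_norm dl0).
rewrite !dotvZr.
(* Since [eps = dl ^+ n.+1], the regularizer scales exactly like [dl], as does the linear term. *)
have e1 (z : R) : (eps * n.+2%:R)^-1 * (dl * z) ^+ n.+2 = dl * (z ^+ n.+2 / n.+2%:R).
  rewrite -dlE exprMn [dl ^+ n.+2]exprS.
  by field; rewrite expf_neq0 ?gt_eqF.
have e2 (z : R) : z = dl * (z / dl) by rewrite mulrC divfK// gt_eqF.
move=> H; rewrite !e1 [taylor_tail f n x (dl *: u)]e2 [taylor_tail f n x (dl *: w)]e2 in H.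
exact: (scale_cancel dl0 H).
Unshelve. all: by end_near.
Qed.

(** On the singleton [[set x]] the derivatives are trivially bounded, so the uniform estimate
    applies under mere differentiability. *)
Lemma gradient_update_velocity (f : 'rV[R]_d -> R) (x : 'rV[R]_d)
    (y : R -> 'rV[R]_d) : times_differentiable n.+1 f ->
    (forall eps, 0 < eps -> gradient_update n.+2 eps f x (y eps)) ->
  (time_step n.+2 eps)^-1 *: (y eps - x) @[eps --> (0 : R)^'+]
    --> rescaled_field n.+2 f x.
Proof.
move=> df yx; apply/cvg_enormP => e e0.
have e20 : 0 < e / 2 by rewrite divr_gt0.
have H : \forall eps \near (0 : R)^'+, forall y', gradient_update n.+2 eps f x y' ->
    enorm (y' - x - time_step n.+2 eps *: rescaled_field n.+2 f x)
      <= e / 2 * time_step n.+2 eps.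
  have bd ws : (size ws <= n.+1)%N ->
      exists C, forall z, [set x] z -> `|nabla f ws z| <= C.
    by move=> _; exists `|nabla f ws x| => z ->.
  by apply: filterS (gradient_update_consistent df bd e20) => eps Heps y'; exact: Heps.
near=> eps.
have eps0 : 0 < eps by near: eps; exact: nbhs_right_gt.
have dl0 := time_step_gt0 eps0.
have : enorm (y eps - x - time_step n.+2 eps *: rescaled_field n.+2 f x) <=
    e / 2 * time_step n.+2 eps.
  by move: (yx _ eps0); move: (y eps); near: eps; exact: H.
move: (time_step n.+2 eps) dl0 => dl dl0 Hdl.
have -> : dl^-1 *: (y eps - x) - rescaled_field n.+2 f x =
    dl^-1 *: (y eps - x - dl *: rescaled_field n.+2 f x).
  by rewrite [RHS]scalerBr scalerA mulVf ?scale1r// gt_eqF.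
rewrite enormZ gtr0_norm ?invr_gt0// mulrC ltr_pdivrMr//.
by apply: (le_lt_trans Hdl); rewrite ltr_pM2r// ltr_pdivrMr// ltr_pMr// ltr1n.
Unshelve. all: by end_near.
Qed.

End Consistency.

(** * Convexity and the convergence rate *)

Section Convexity.
Variables (R : realType) (d : nat) (f : 'rV[R]_d -> R).
Hypothesis df : forall x, differentiable (f : _ -> R^o) x.
Hypothesis hconv : convex_function setT f.
Implicit Types (x y u v : 'rV[R]_d).

Lemma convex_function_le x y (h : R) : 0 <= h -> h <= 1 ->
  f (h *: (y - x) + x) <= f x + h * (f y - f x).
Proof.
move=> h0 h1; have := hconv (Itv01 h0 h1) (in_setT y) (in_setT x).
rewrite convRE /= /conv /= /unstable.onem.
have -> : h *: (y - x) + x = h *: y + (1 - h) *: x.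
  by rewrite scalerBr scalerBl scale1r -!addrA; congr (_ + _); rewrite addrC.
by move=> /le_trans; apply; rewrite le_eqVlt; apply/orP; left; apply/eqP; ring.
Qed.

Lemma convex_grad_le x y : f x + dotv (grad f x) (y - x) <= f y.
Proof.
rewrite -lerBrDl -derive_dotv_grad//.
have /cvg_dnbhs_at_right Dc : h^-1 *: ((f \o shift x) (h *: (y - x)) - f x)
    @[h --> (0 : R)^'] --> ('D_(y - x) (f : _ -> R^o) x : R).
  exact: (diff_derivable (df x)).
apply: (cvgr_to_le Dc); near=> h.
have h0 : 0 < h by near: h; exact: nbhs_right_gt.
have h1 : h <= 1 by near: h; exact: nbhs_right_le.
rewrite /= -[_ *: _]/(_ * _) mulrC ler_pdivrMr// lerBlDl mulrC.
by rewrite convex_function_le// ltW.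
Unshelve. all: by end_near.
Qed.

Lemma grad_monotone x y : 0 <= dotv (grad f x - grad f y) (x - y).
Proof.
have := convex_grad_le x y; have := convex_grad_le y x.
by rewrite dotvBl -[y - x]opprB dotvNr; lra.
Qed.

Variable xstar : 'rV[R]_d.
Hypothesis hmin : unique_minimizer f xstar.

Lemma le_minimizer x : f x <= f xstar -> x = xstar.
Proof.
by have [m u] := hmin => fx; apply: u => z; rewrite (le_trans fx).
Qed.

Lemma grad_eq0 x : grad f x = 0 -> x = xstar.
Proof.
move=> g0; apply: le_minimizer.
by have := convex_grad_le x xstar; rewrite g0 dotv0l addr0.
Qed.

(** On the unit sphere about [xstar] the function is at least some [m > f xstar]. A point at
    distance [r > 1] is shrunk onto that sphere, and convexity forces its value to exceed the
    minimum by at least [r * (m - f xstar)]. *)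
Lemma sublevel_bounded c : exists2 r, 0 <= r &
  forall x, f x <= c -> enorm (x - xstar) <= r.
Proof.
have [m m0 Hm] : exists2 m, f xstar < m & forall x, enorm (x - xstar) = 1 -> m <= f x.
  pose S := [set x | enorm (x - xstar) = 1].
  (* In dimension 0 the sphere is empty, and any value above the minimum serves. *)
  have [S0|/set0P/negP/negPn/eqP S0] := pselect (S !=set0); last first.
    exists (f xstar + 1) => [|x xS]; first by rewrite ltrDl.
    by exfalso; rewrite -[False]/(set0 x) -S0.
  have cS : compact S.
    apply: (@subclosed_compact _ _ [set x | enorm (x - xstar) <= 1]).
    - apply: (@closed_comp _ _ (fun y : 'rV[R]_d => enorm (y - xstar)) [set t | t = 1]).
        by move=> y _; exact: enorm_dist_continuous.
      exact: closed_eq.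
    - exact: closed_ball_compact.
    - by move=> x /= ->.
  have cf : {within S, continuous f}.
    apply: continuous_subspaceT => x.
    by have := differentiable_continuous (df x).
  have [z /set_mem zS Hz] := compact_EVT_min S0 cS cf.
  exists (f z) => [|x xS]; last by apply: Hz; exact/mem_set.
  rewrite ltNge; apply/negP => /le_minimizer zE.
  by move: zS; rewrite /S /= zE subrr enorm0 => /eqP; rewrite eq_sym oner_eq0.
exists (Num.max 1 ((c - f xstar) / (m - f xstar))); first by rewrite le_max ler01.
move=> x fx; rewrite le_max; case: leP => //= r1.
have m0' : 0 < m - f xstar by rewrite subr_gt0.
have r0 : 0 < enorm (x - xstar) by apply: lt_trans r1.
rewrite ler_pdivlMr//.
set r := enorm (x - xstar) in r0 r1 *.
have ri1 : r^-1 <= 1 by rewrite invf_le1// ltW.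
have ri0 : 0 <= r^-1 by rewrite invr_ge0 ltW.
have := convex_function_le xstar x ri0 ri1.
have /Hm : enorm (r^-1 *: (x - xstar) + xstar - xstar) = 1.
  by rewrite addrK enormZ ger0_norm// mulVf// gt_eqF.
move=> H1 H2; have {H1 H2}H := le_trans H1 H2.
have : (m - f xstar) <= r^-1 * (f x - f xstar) by lra.
by rewrite mulrC ler_pdivlMr// mulrC => /le_trans; apply; lra.
Qed.

End Convexity.

(** * Energy decrease and convergence rate along the flow *)

Section Flow.
Variables (R : realType) (d n : nat) (f : 'rV[R]_d -> R) (xstar : 'rV[R]_d).
Hypothesis df : forall x, differentiable (f : _ -> R^o) x.
Hypothesis hconv : convex_function setT f.
Hypothesis hmin : unique_minimizer f xstar.
Local Notation F := (rescaled_field n.+2 f).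

Lemma is_derive_comp_curve (g : 'rV[R]_d -> R) (X : R -> 'rV[R]_d) v (t : R) :
  differentiable (g : _ -> R^o) (X t) -> is_derive t 1 X v ->
  is_derive t 1 (g \o X) (dotv (grad g (X t)) v).
Proof.
move=> dg [dX <-]; have dX' := (derivable1_diffP X t).1 dX.
have dgX : differentiable (g \o X : R -> R^o) t := differentiable_comp dX' dg.
split; first exact: diff_derivable.
rewrite (deriveE _ dgX) (diff_comp dX' dg) /= -(deriveE _ dX').
by rewrite -derive_dotv_grad// (deriveE _ dg).
Qed.

Variables (x0 : 'rV[R]_d) (X : R -> 'rV[R]_d).
Hypothesis hX : rescaled_gradient_flow n.+2 f x0 X.

Lemma flow_value_continuous : {within `[0, +oo[, continuous (f \o X)}.
Proof.
have [_ /subspace_continuousP cX _] := hX.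
apply/subspace_continuousP => t /cX Xt; apply: cvg_comp Xt _.
by have := differentiable_continuous (df (X t)).
Qed.

Lemma flow_value_derive (t : R) : 0 < t ->
  is_derive t 1 (f \o X) (- enorm (F (X t)) ^+ n.+2).
Proof.
move=> t0; have [_ _ dX] := hX.
rewrite -dotv_grad_rescaled_field.
exact: is_derive_comp_curve (df _) (dX t t0).
Qed.

Lemma flow_value_nincr (s t : R) : 0 <= s -> s <= t -> f (X t) <= f (X s).
Proof.
move=> s0 st; apply: (ler0_derive1_nincry (f := f \o X) (a := 0)) => //.
- move=> u; rewrite in_itv /= andbT => u0.
  by have [] := flow_value_derive u0.
- move=> u; rewrite in_itv /= andbT => u0; rewrite derive1E.
  by have [_ ->] := flow_value_derive u0; rewrite oppr_le0 exprn_ge0// enorm_ge0.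
- exact: flow_value_continuous.
Qed.

Lemma flow_value_le (t : R) : 0 <= t -> f (X t) <= f x0.
Proof. by move=> t0; have [<- _ _] := hX; exact: flow_value_nincr. Qed.

Lemma le_level_radius x : f x <= f x0 -> enorm (x - xstar) <= level_radius f xstar x0.
Proof.
move=> fx; apply: ub_le_sup; last by exists x.
have [r _ Hr] := sublevel_bounded df hconv hmin (f x0).
by exists r => _ [y /= fy <-]; exact: Hr.
Qed.

Lemma flow_rate (t : R) : 0 < t ->
  t ^+ n.+1 * (f (X t) - f xstar) <=
    n.+1%:R ^+ n.+1 * level_radius f xstar x0 ^+ n.+2.
Proof.
set r := level_radius f xstar x0; set K := n.+1%:R ^+ n.+1 * _ => t0.
have r0 : 0 <= r by rewrite (le_trans (enorm_ge0 (x0 - xstar)))// le_level_radius.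
pose V := fun s : R => s ^+ n.+2 * (f (X s) - f xstar) - K * s.
have dV (s : R) : 0 < s -> is_derive s 1 V
    (n.+2%:R * s ^+ n.+1 * (f (X s) - f xstar) - s ^+ n.+2 * enorm (F (X s)) ^+ n.+2 - K).
  move=> s0; have Hf := flow_value_derive s0.
  have -> : V = (@id R ^+ n.+2 * (f \o X - cst (f xstar)) - cst K * id).
    by apply/funext => u; rewrite /V !fctE.
  apply: is_derive_eq.
  rewrite /GRing.scale /= /cst !fctE /=; ring.
have cV : {within `[0, +oo[, continuous V}.
  have /subspace_continuousP cf := flow_value_continuous.
  apply/subspace_continuousP => s /cf Hs.
  have cid : @id R @ within `[0, +oo[ (nbhs s) --> s.
    by apply: cvg_within_filter; exact: cvg_id.
  apply: cvgB; last by apply: cvgM; [exact: cvg_cst|exact: cid].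
  apply: cvgM; last by apply: cvgB; [exact: Hs|exact: cvg_cst].
  apply: (@cvg_comp _ _ _ id (fun u : R => u ^+ n.+2) _ _ _ cid).
  exact: exprn_continuous.
have : V t <= V 0.
  apply: (ler0_derive1_nincry (f := V) (a := 0)) => //; last exact: ltW.
  - by move=> s; rewrite in_itv /= andbT => s0; have [] := dV _ s0.
  move=> s; rewrite in_itv /= andbT => s0; rewrite derive1E.
  have [_ ->] := dV _ s0.
  have [Fg _] := enorm_rescaled_field n f (X s).
  set m := enorm (F (X s)) in Fg *.
  have m0 : 0 <= m := enorm_ge0 _.
  (* Convexity bounds the gap by the gradient norm, which is [m ^+ n.+1], times the distance to the
     minimizer; the flow never leaves the initial level set, so this distance is at most [r]. *)
  have H1 : f (X s) - f xstar <= m ^+ n.+1 * r.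
    have := convex_grad_le df hconv (X s) xstar.
    have := dotv_le (grad f (X s)) (X s - xstar).
    rewrite -Fg -[xstar - X s]opprB dotvNr => H2 H3.
    have H4 : m ^+ n.+1 * enorm (X s - xstar) <= m ^+ n.+1 * r.
      by rewrite ler_wpM2l ?exprn_ge0// le_level_radius// flow_value_le// ltW.
    lra.
  have sm0 : 0 <= s * m by rewrite mulr_ge0// ltW.
  have nr0 : 0 <= n.+1%:R * r by rewrite mulr_ge0.
  (* Taking [t = s * m] and [c = n.+1%:R * r], then dividing by [n.+1%:R], produces exactly the
     constant [K]. *)
  have H2 := tangent_power_le n.+1 sm0 nr0.
  have H3 : n.+2%:R * ((s * m) ^+ n.+1 * r) <= (s * m) ^+ n.+2 + K.
    have n0 : 0 < n.+1%:R :> R by [].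
    have E : (n.+1%:R * r) ^+ n.+2 = n.+1%:R * K.
      by rewrite exprMn [n.+1%:R ^+ n.+2]exprS -mulrA.
    rewrite -(ler_pM2l n0) mulrDr -E (le_trans _ H2)//.
    by rewrite le_eqVlt; apply/orP; left; apply/eqP; ring.
  have H4 : n.+2%:R * s ^+ n.+1 * (f (X s) - f xstar) <=
      n.+2%:R * s ^+ n.+1 * (m ^+ n.+1 * r).
    by rewrite ler_wpM2l// mulr_ge0// exprn_ge0// ltW.
  by move: H3; rewrite !exprMn; lra.
(* As [V 0 = 0], one factor [t] cancels from [V t <= 0]. *)
rewrite /V expr0n/= mul0r mulr0 subr0 exprS -mulrA [K * t]mulrC -mulrBr.
by rewrite pmulr_rle0// subr_le0.
Qed.

End Flow.

(** * Limits of consistent discrete curves *)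

Section Limits.
Variables (R : realType) (d : nat).
Local Notation V := 'rV[R]_d.

(** Only [x] is confined to [K]: a step that starts in the ball may end outside it. *)
Lemma uniformly_continuous_on (K : set V) (h : V -> V) (eta : R) :
  compact K -> continuous h -> 0 < eta ->
  exists2 rho, 0 < rho & forall x y, K x -> enorm (y - x) < rho ->
    enorm (h y - h x) < eta.
Proof.
move=> /compact_near_coveringP cK ch e0.
have e20 : 0 < eta / 2 by rewrite divr_gt0.
have := cK R (0 : R)^'+ (fun rho x => forall y, enorm (y - x) < rho ->
  enorm (h y - h x) < eta) _.
case=> [x Kx|rho /= rho0 Hrho].
  have /cvg_at_enormP /(_ _ e20) /enorm_near[e e'0 He] := ch x.
  have e2 : 0 < e / 2 by rewrite divr_gt0.
  exists ([set y | enorm (y - x) < e / 2], [set rho | rho < e / 2]).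
    split => /=; first by apply/enorm_near; exists (e / 2).
    exact: nbhs_right_lt.
  move=> [x' rho] /= [x'x rhoe] y yx'.
  rewrite (le_lt_trans (enorm_dist _ (h x) _))// (splitr eta) ltrD//.
    apply: He; rewrite (le_lt_trans (enorm_dist _ x' _))// (splitr e) ltrD//.
    exact: lt_trans yx' rhoe.
  by rewrite enormB; apply: He; rewrite (lt_trans x'x)// ltr_pdivrMr// ltr_pMr// ltr1n.
exists (rho / 2); first by rewrite divr_gt0.
move=> x y Kx; apply: Hrho Kx y => /=; last by rewrite divr_gt0.
by rewrite sub0r normrN gtr0_norm ?divr_gt0// ltr_pdivrMr// ltr_pMr// ltr1n.
Qed.

Lemma is_derive_curve (X : R -> V) (t : R) (v : V) :
  (forall e, 0 < e -> exists2 h, 0 < h & forall s, `|s - t| < h ->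
     enorm (X s - X t - (s - t) *: v) <= e * `|s - t|) ->
  is_derive t 1 X v.
Proof.
move=> H.
have c : h^-1 *: ((X \o shift t) (h *: (1 : R)) - X t) @[h --> (0 : R)^'] --> v.
  apply/cvg_enormP => e e0.
  have e20 : 0 < e / 2 by rewrite divr_gt0.
  have [h h0 Hh] := H _ e20.
  near=> s.
  have s0 : s != 0 by near: s; exact: nbhs_dnbhs_neq.
  have sh : `|s| < h by near: s; exact: dnbhs0_lt.
  have := Hh (s + t); rewrite addrK => /(_ sh) Hs.
  rewrite /= [s *: 1]mulr1.
  have -> : s^-1 *: (X (s + t) - X t) - v = s^-1 *: (X (s + t) - X t - s *: v).
    by rewrite [RHS]scalerBr scalerA mulVf// scale1r.
  rewrite enormZ normfV mulrC ltr_pdivrMr ?normr_gt0//.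
  rewrite (le_lt_trans Hs)// ltr_pM2r ?normr_gt0//.
  by rewrite ltr_pdivrMr// ltr_pMr// ltr1n.
by split; [exact: cvgP c|exact: cvg_lim c].
Unshelve. all: by end_near.
Qed.

(** Discrete substitute for integrating the velocity over a time interval. *)
Lemma enorm_telescope (u : nat -> V) (v : V) (c : R) j k : (j <= k)%N ->
  (forall m, (j <= m < k)%N -> enorm (u m.+1 - u m - v) <= c) ->
  enorm (u k - u j - (k%:R - j%:R) *: v) <= c * (k%:R - j%:R).
Proof.
elim: k => [|k IH].
  by rewrite leqn0 => /eqP -> _; rewrite !subrr scale0r subr0 enorm0 mulr0.
rewrite leq_eqVlt => /orP[/eqP ->|].
  by move=> _; rewrite !subrr scale0r subr0 enorm0 mulr0.
rewrite ltnS => jk H.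
have -> : u k.+1 - u j - (k.+1%:R - j%:R) *: v =
    (u k.+1 - u k - v) + (u k - u j - (k%:R - j%:R) *: v).
  rewrite -natr1 !scalerBl scalerDl scale1r.
  by apply/rowP => i; rewrite !mxE; ring.
rewrite (le_trans (enormD _ _))//.
have H1 : enorm (u k.+1 - u k - v) <= c by apply: H; rewrite jk ltnSn.
have H2 : enorm (u k - u j - (k%:R - j%:R) *: v) <= c * (k%:R - j%:R).
  by apply: IH => // m /andP[jm mk]; apply: H; rewrite jm ltnW.
by rewrite -natr1; lra.
Qed.

Lemma ultra_fmap (I T : Type) (U : set_system I) (g : I -> T) :
  UltraFilter U -> UltraFilter (g @ U).
Proof.
move=> UU; split; first exact: fmap_proper_filter.
move=> G GG UG; apply/seteqP; split; last exact: UG.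
move=> A GA; have [//|UA] := in_ultra_setVsetC (g @^-1` A) UU.
have /UG GnA : (g @ U) (~` A) by [].
have : G set0 by rewrite -(setICr A); exact: filterI.
by move=> /(@filter_not_empty _ _ GG).
Qed.

Lemma truncn_step (t dl : R) : 0 < dl -> 0 <= t ->
  dl * (Num.truncn (t / dl))%:R <= t /\ t < dl * (Num.truncn (t / dl))%:R + dl.
Proof.
move=> dl0 t0; have /truncn_itv/andP[] : 0 <= t / dl by rewrite divr_ge0// ltW.
rewrite ler_pdivlMr// ltr_pdivrMr// mulrC => -> H; split => //.
by move: H; rewrite -natr1 mulrDl mul1r mulrC.
Qed.

End Limits.

(* If a family of discrete curves with step tending to [0] is asymptotically
   consistent with the field, then along an ultrafilter it converges, and the
   limit solves the flow equation: compactness replaces Arzela-Ascoli, and the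
   derivative is read off the telescoped increments, without integrals. *)
Section UltraLimit.
Variables (R : realType) (d n : nat) (f : 'rV[R]_d -> R) (xstar : 'rV[R]_d).
Hypothesis hC1 : times_continuously_differentiable 1 f.
Hypothesis hconv : convex_function setT f.
Hypothesis hmin : unique_minimizer f xstar.
Local Notation F := (rescaled_field n.+2 f).

Variables (I : Type) (U : set_system I) (dl : I -> R) (x : I -> nat -> 'rV[R]_d).
Variable x0 : 'rV[R]_d.
Hypothesis UU : UltraFilter U.
Hypothesis dl_gt0 : \forall i \near U, 0 < dl i.
Hypothesis dl_cvg0 : forall e : R, 0 < e -> \forall i \near U, dl i < e.
Hypothesis x_init : forall i, x i 0 = x0.
Hypothesis x_consistent : forall r eta : R, 0 < eta ->
  \forall i \near U, forall k, enorm (x i k - xstar) <= r ->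
    enorm (x i k.+1 - x i k - dl i *: F (x i k)) <= eta * dl i.

Let df y : differentiable (f : _ -> R^o) y.
Proof. by have [H _] := hC1; exact: (H [::]). Qed.

Let grad_cont : continuous (grad f) := continuous_grad hC1.
Let field_cont : continuous F := continuous_rescaled_field grad_cont.

Lemma ball_bounded (h : 'rV[R]_d -> 'rV[R]_d) r : continuous h ->
  exists2 C, 0 <= C & forall y, enorm (y - xstar) <= r -> enorm (h y) <= C.
Proof.
move=> ch.
have ceh : continuous (fun y => enorm (h y)).
  move=> y; apply: (@continuous_comp _ _ _ h (@enorm R d)); first exact: ch.
  exact: enorm_continuous.
have [C HC] := continuous_bounded_on (@closed_ball_compact _ _ xstar r) ceh.
exists `|C| => // y yr; rewrite (le_trans (ler_norm _))// (le_trans (HC y yr))//.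
exact: ler_norm.
Qed.

(** Convexity at the new point [z] gives [f z - f y <= dotv (grad f z) (z - y)]. Replacing
    [grad f z] by [grad f y] costs little by uniform continuity, and [dotv (grad f y) (F y)] is
    nonpositive; each error gets half of [eta]. *)
Lemma consistent_descent r eta : 0 < eta ->
  \forall i \near U, forall k, enorm (x i k - xstar) <= r ->
    f (x i k.+1) <= f (x i k) + eta * dl i.
Proof.
move=> eta0.
have [M M0 HM] := ball_bounded r field_cont.
have [G G0 HG] := ball_bounded r grad_cont.
have M1 : 0 < M + 1 by rewrite ltr_wpDl.
have G1 : 0 < G + 1 by rewrite ltr_wpDl.
have eta20 : 0 < eta / (2 * (M + 1)) by rewrite divr_gt0// mulr_gt0.
have [rho rho0 Hrho] :=
  uniformly_continuous_on (@closed_ball_compact _ _ xstar r) grad_cont eta20.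
(* The entry 1 bounds the step length by [(M + 1) * dl i]; the other pays for pairing the
   consistency error with the gradient. *)
have eta10 : 0 < Num.min 1 (eta / (2 * (G + 1))).
  by rewrite lt_min ltr01 divr_gt0// mulr_gt0.
have rM0 : 0 < rho / (M + 1) by rewrite divr_gt0.
near=> i => k xr.
have dl0 : 0 < dl i by near: i; exact: dl_gt0.
have dlr : dl i < rho / (M + 1) by near: i; exact: dl_cvg0.
have Hi : enorm (x i k.+1 - x i k - dl i *: F (x i k)) <=
    Num.min 1 (eta / (2 * (G + 1))) * dl i.
  by move: k xr; near: i; exact: x_consistent.
move: Hi; set y := x i k; set z := x i k.+1; set w := z - y - _ => Hi.
have w1 : enorm w <= dl i.
  apply: (le_trans Hi); apply: ler_piMl; first exact: ltW.
  by rewrite ge_min lexx.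
have w2 : enorm w <= eta / (2 * (G + 1)) * dl i.
  apply: (le_trans Hi); apply: ler_wpM2r; first exact: ltW.
  by rewrite ge_min lexx orbT.
have zy : z - y = w + dl i *: F y by rewrite subrK.
have zyM : enorm (z - y) <= (M + 1) * dl i.
  rewrite zy (le_trans (enormD _ _))// enormZ gtr0_norm//.
  have := ler_wpM2l (ltW dl0) (HM _ xr); rewrite -/y; lra.
have /Hrho : enorm (z - y) < rho.
  by rewrite (le_lt_trans zyM)// mulrC -ltr_pdivlMr.
move=> /(_ xr) Hg.
have H1 := convex_grad_le df hconv z y.
have H2 : dotv (grad f z - grad f y) (z - y) <= eta / 2 * dl i.
  rewrite (le_trans (dotv_le _ _))//.
  apply: (@le_trans _ _ (eta / (2 * (M + 1)) * ((M + 1) * dl i))).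
    by rewrite ler_pM ?enorm_ge0// ltW.
  rewrite le_eqVlt; apply/orP; left; apply/eqP; field.
  by rewrite gt_eqF.
have H3 : dotv (grad f y) (z - y) <= eta / 2 * dl i.
  rewrite zy dotvDr dotvZr dotv_grad_rescaled_field.
  have : 0 <= dl i * enorm (F y) ^+ n.+2 by rewrite mulr_ge0 ?exprn_ge0 ?enorm_ge0// ltW.
  have : dotv (grad f y) w <= (G + 1) * (eta / (2 * (G + 1)) * dl i).
    rewrite (le_trans (dotv_le _ _))// ler_pM ?enorm_ge0//.
    by rewrite (le_trans (HG _ xr))// lerDl.
  have -> : (G + 1) * (eta / (2 * (G + 1)) * dl i) = eta / 2 * dl i.
    by field; rewrite gt_eqF.
  by lra.
move: H1 H2; rewrite dotvBl -[y - z]opprB dotvNr.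
by lra.
Unshelve. all: by end_near.
Qed.

(** The radius is chosen before [T]: the allowed increase per unit of time is
    [(Num.max T 0 + 1)^-1], so up to time [T] the value rises by at most 1. The induction carries
    value and position together, because descent is available only inside the ball. *)
Lemma consistent_bounded : exists r, forall T,
  \forall i \near U, forall k, dl i * k%:R <= T -> enorm (x i k - xstar) <= r.
Proof.
have [r _ Hr] := sublevel_bounded df hconv hmin (f x0 + 1).
exists r => T.
have T0 : 0 < Num.max T 0 + 1 by rewrite ltr_wpDl// le_max lexx orbT.
have Ti0 : 0 < (Num.max T 0 + 1)^-1 by rewrite invr_gt0.
near=> i.
have dl0 : 0 < dl i by near: i; exact: dl_gt0.
have Hi : forall k, enorm (x i k - xstar) <= r ->
    f (x i k.+1) <= f (x i k) + (Num.max T 0 + 1)^-1 * dl i.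
  by near: i; exact: consistent_descent.
suff H : forall k, dl i * k%:R <= T ->
    f (x i k) <= f x0 + (Num.max T 0 + 1)^-1 * (dl i * k%:R) /\
    enorm (x i k - xstar) <= r.
  by move=> k kT; have [] := H k kT.
have step k : dl i * k%:R <= T ->
    f (x i k) <= f x0 + (Num.max T 0 + 1)^-1 * (dl i * k%:R) ->
    enorm (x i k - xstar) <= r.
  move=> kT H; apply: Hr; rewrite (le_trans H)// lerD2l mulrC ler_pdivrMr// mul1r.
  by rewrite (le_trans kT)// (@le_trans _ _ (Num.max T 0))// ?lerDl// le_max lexx.
elim=> [|k IH] kT.
  by have H : f (x i 0) <= f x0 + (Num.max T 0 + 1)^-1 * (dl i * 0%:R);
    [rewrite x_init !mulr0 addr0|split; [exact: H|exact: step]].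
have kT' : dl i * k%:R <= T.
  by rewrite (le_trans _ kT)// ler_pM2l// ler_nat.
have [H1 H2] := IH kT'.
have H : f (x i k.+1) <= f x0 + (Num.max T 0 + 1)^-1 * (dl i * k.+1%:R).
  rewrite (le_trans (Hi _ H2))// -natr1.
  by move: H1; move: (_^-1) => c; lra.
by split; [exact: H|exact: step].
Unshelve. all: by end_near.
Qed.

Let radius := sval (cid consistent_bounded).

Let in_ball T : \forall i \near U, forall k, dl i * k%:R <= T ->
  enorm (x i k - xstar) <= radius.
Proof. exact: (svalP (cid consistent_bounded)). Qed.

(** The term [dl i] accounts for rounding the two times to the grid. *)
Lemma consistent_lipschitz : exists2 B, 0 < B & forall T,
  \forall i \near U, forall a b, 0 <= a -> a <= b -> b <= T ->
    enorm (x i (Num.truncn (b / dl i)) - x i (Num.truncn (a / dl i)))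
      <= B * (b - a + dl i).
Proof.
have [M M0 HM] := ball_bounded radius field_cont.
exists (M + 1) => [|T]; first by rewrite ltr_wpDl.
near=> i.
have dl0 : 0 < dl i by near: i; exact: dl_gt0.
have Hb : forall k, dl i * k%:R <= T -> enorm (x i k - xstar) <= radius.
  by near: i; exact: in_ball.
have Hc : forall k, enorm (x i k - xstar) <= radius ->
    enorm (x i k.+1 - x i k - dl i *: F (x i k)) <= 1 * dl i.
  by near: i; apply: x_consistent.
move=> a b a0 ab bT; have b0 := le_trans a0 ab.
set j := Num.truncn (a / dl i); set k := Num.truncn (b / dl i).
have jk : (j <= k)%N by apply: le_truncn; rewrite ler_pM2r// invr_gt0.
have [k1 k2] := truncn_step dl0 b0; have [j1 j2] := truncn_step dl0 a0.
have := @enorm_telescope _ _ (x i) 0 ((M + 1) * dl i) j k jk.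
rewrite scaler0 subr0 => H; apply: (le_trans (H _)).
  move=> m /andP[_ mk]; rewrite subr0.
  have mT : dl i * m%:R <= T.
    by rewrite (le_trans _ bT)// (le_trans _ k1)// ler_pM2l// ler_nat ltnW.
  have xr := Hb _ mT.
  rewrite -[x i m.+1 - x i m](subrK (dl i *: F (x i m))) (le_trans (enormD _ _))//.
  rewrite enormZ gtr0_norm// mulrDl addrC lerD ?Hc// mulrC ler_pM2r//.
  exact: HM.
rewrite -mulrA ler_wpM2l//; first by rewrite addr_ge0.
by rewrite mulrBr -/j -/k in k1 k2 j1 j2 *; lra.
Unshelve. all: by end_near.
Qed.

(** An ultrafilter on a compact ball converges. The condition [0 <= t] sits under the existential so
    that choice yields a total curve. *)
Lemma ultra_limit_exists (t : R) : exists l : 'rV[R]_d, 0 <= t ->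
  forall e, 0 < e -> \forall i \near U, enorm (x i (Num.truncn (t / dl i)) - l) < e.
Proof.
have [t0|_] := boolP (0 <= t); last by exists 0.
have inB : \forall i \near U, enorm (x i (Num.truncn (t / dl i)) - xstar) <= radius.
  near=> i.
  have dl0 : 0 < dl i by near: i; exact: dl_gt0.
  have [H _] := truncn_step dl0 t0; move: (Num.truncn _) H.
  by near: i; exact: in_ball.
have := @closed_ball_compact _ _ xstar radius; rewrite compact_ultra => cB.
have [|l [_ /= Hl]] := cB _ (ultra_fmap (fun i => x i (Num.truncn (t / dl i))) UU).
  exact: inB.
exists l => _ e e0.
exact: ((cvg_enormP (fun i => x i (Num.truncn (t / dl i))) l).1 Hl).
Unshelve. all: by end_near.
Qed.


Lemma ultra_limit_flow : exists X : R -> 'rV[R]_d,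
  rescaled_gradient_flow n.+2 f x0 X /\
  forall T eta, 0 < eta -> \forall i \near U, forall k,
    dl i * k%:R <= T -> enorm (x i k - X (dl i * k%:R)) < eta.
Proof.
have [X HX] := choice ultra_limit_exists.
have [B B0 HB] := consistent_lipschitz.
have PU : ProperFilter U by exact: ultra_proper.
have LX a b : 0 <= a -> a <= b -> enorm (X b - X a) <= B * (b - a).
  move=> a0 ab; have b0 := le_trans a0 ab; apply/ler_addgt0Pr => e e0.
  have e30 : 0 < e / 3 by rewrite divr_gt0.
  have eB : 0 < e / 3 / B by rewrite divr_gt0.
  near U => i.
  have Ha : enorm (x i (Num.truncn (a / dl i)) - X a) < e / 3.
    by near: i; exact: HX.
  have Hb : enorm (x i (Num.truncn (b / dl i)) - X b) < e / 3.
    by near: i; exact: HX.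
  have Hab : enorm (x i (Num.truncn (b / dl i)) - x i (Num.truncn (a / dl i)))
      <= B * (b - a + dl i).
    have Hlip : forall u v, 0 <= u -> u <= v -> v <= b ->
        enorm (x i (Num.truncn (v / dl i)) - x i (Num.truncn (u / dl i)))
          <= B * (v - u + dl i).
      by near: i; exact: HB.
    exact: Hlip.
  have : dl i < e / 3 / B by near: i; exact: dl_cvg0.
  rewrite ltr_pdivlMr// => dle.
  have := enorm_dist (X b) (x i (Num.truncn (b / dl i))) (X a).
  have := enorm_dist (x i (Num.truncn (b / dl i))) (x i (Num.truncn (a / dl i))) (X a).
  by rewrite [enorm (X b - x i _)]enormB; lra.
have X0 : X 0 = x0.
  apply/eqP; rewrite -subr_eq0 -enorm_eq0 eq_le enorm_ge0 andbT.
  apply/ler_addgt0Pr => e e0; rewrite add0r ltW//.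
  near U => i.
  have : enorm (x i (Num.truncn (0 / dl i)) - X 0) < e by near: i; exact: HX.
  by rewrite mul0r truncn0 x_init enormB.
have DX (t : R) : 0 < t -> is_derive t 1 X (F (X t)).
  move=> t0; apply: is_derive_curve => e e0.
  have e30 : 0 < e / 3 by rewrite divr_gt0.
  have /cvg_at_enormP /(_ _ e30) /enorm_near[rho rho0 Hrho] := @field_cont (X t).
  have rho30 : 0 < rho / 3 by rewrite divr_gt0.
  have rho60 : 0 < rho / 6 by rewrite divr_gt0.
  have h0 : 0 < Num.min t (rho / 3 / B) by rewrite lt_min t0 divr_gt0.
  exists (Num.min t (rho / 3 / B)) => //.
  set h := Num.min _ _ in h0 *.
  have hB : B * h <= rho / 3.
    by rewrite mulrC -ler_pdivlMr// /h ge_min lexx orbT.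
  have ht : h <= t by rewrite /h ge_min lexx.
  (* Two arbitrary times around [t] cover both sides of the derivative; [c] is the error of
     replacing [X] by a discrete curve and rounding times to its grid. *)
  have key a b : t - h <= a -> a <= b -> b <= t + h ->
      enorm (X b - X a - (b - a) *: F (X t)) <= e * (b - a).
    move=> ta ab bt; apply/ler_addgt0Pr => c c0.
    have a0 : 0 <= a by lra.
    have b0 : 0 <= b by lra.
    pose N := enorm (F (X t)) + e.
    have N0 : 0 < N by rewrite ltr_wpDl ?enorm_ge0.
    have c40 : 0 < c / 4 by rewrite divr_gt0.
    near U => i.
    have dl0 : 0 < dl i by near: i; exact: dl_gt0.
    have Ha : enorm (x i (Num.truncn (a / dl i)) - X a) < c / 4.
      by near: i; exact: HX.
    have Hb : enorm (x i (Num.truncn (b / dl i)) - X b) < c / 4.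
      by near: i; exact: HX.
    have Ht : enorm (x i (Num.truncn (t / dl i)) - X t) < rho / 3.
      by near: i; apply: HX => //; exact: ltW.
    have dlN : dl i * N < c / 4.
      by rewrite -ltr_pdivlMr//; near: i; apply: dl_cvg0; rewrite divr_gt0.
    have dlB : dl i * B < rho / 6.
      by rewrite -ltr_pdivlMr//; near: i; apply: dl_cvg0; rewrite divr_gt0.
    have Hin : forall k, dl i * k%:R <= t + h -> enorm (x i k - xstar) <= radius.
      by near: i; exact: in_ball.
    have Hlip : forall a b, 0 <= a -> a <= b -> b <= t + h ->
        enorm (x i (Num.truncn (b / dl i)) - x i (Num.truncn (a / dl i)))
          <= B * (b - a + dl i).
      by near: i; exact: HB.
    have Hc : forall k, enorm (x i k - xstar) <= radius ->
        enorm (x i k.+1 - x i k - dl i *: F (x i k)) <= e / 3 * dl i.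
      by near: i; exact: x_consistent.
    have [k1 k2] := truncn_step dl0 b0; have [j1 j2] := truncn_step dl0 a0.
    set k := Num.truncn (b / dl i) in k1 k2 Hb.
    set j := Num.truncn (a / dl i) in j1 j2 Ha.
    have jk : (j <= k)%N by apply: le_truncn; rewrite ler_pM2r// invr_gt0.
    (* One [e / 3] is the consistency error, the other the variation of the field near [X t]. *)
    have H : enorm (x i k - x i j - (k%:R - j%:R) *: (dl i *: F (X t)))
        <= 2 * (e / 3) * dl i * (k%:R - j%:R).
      apply: enorm_telescope => // m /andP[jm mk].
      have jm' : dl i * j%:R <= dl i * m%:R by rewrite ler_pM2l// ler_nat.
      have mk' : dl i * m%:R <= dl i * k%:R by rewrite ler_pM2l// ler_nat ltnW.
      have mE : Num.truncn (dl i * m%:R / dl i) = m.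
        by rewrite mulrAC mulfV ?mul1r ?natrK// gt_eqF.
      have m0 : 0 <= dl i * m%:R by rewrite mulr_ge0// ltW.
      have xm : enorm (x i m - x i (Num.truncn (t / dl i))) <= B * (h + dl i + dl i).
        have [mt|/ltW tm] := leP (dl i * m%:R) t.
          have := Hlip _ _ m0 mt; rewrite mE enormB => /(_ _)/le_trans; apply.
            by rewrite lerDl ltW.
          by rewrite ler_wpM2l// ?(ltW B0)//; lra.
        have := Hlip _ _ (ltW t0) tm; rewrite mE => /(_ _)/le_trans; apply; first by lra.
        by rewrite ler_wpM2l// ?(ltW B0)//; lra.
      have xmt : enorm (x i m - X t) < rho.
        have := enorm_dist (x i m) (x i (Num.truncn (t / dl i))) (X t); lra.
      have Hm := Hc m (Hin m _); have {}Hm := Hm (le_trans mk' (le_trans k1 bt)).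
      rewrite -(subrKA (dl i *: F (x i m))) -scalerBr.
      rewrite (le_trans (enormD _ _))// enormZ (gtr0_norm dl0).
      have := ler_wpM2l (ltW dl0) (ltW (Hrho _ xmt)); lra.
    have -> : X b - X a - (b - a) *: F (X t) = (X b - x i k) + (x i j - X a) +
        (x i k - x i j - (k%:R - j%:R) *: (dl i *: F (X t))) +
        ((k%:R - j%:R) * dl i - (b - a)) *: F (X t).
      by rewrite scalerA [in RHS]scalerBl; apply/rowP => q; rewrite !mxE; ring.
    rewrite (le_trans (enormD _ _))//.
    have := enormD (X b - x i k) (x i j - X a).
    have := enormD (X b - x i k + (x i j - X a))
      (x i k - x i j - (k%:R - j%:R) *: (dl i *: F (X t))).
    rewrite enormZ [enorm (X b - x i k)]enormB.
    have dkj : `|(k%:R - j%:R) * dl i - (b - a)| <= dl i.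
      by rewrite ler_norml; apply/andP; split; lra.
    have Fdl := ler_wpM2r (enorm_ge0 (F (X t))) dkj.
    have He : 2 * (e / 3) * dl i * (k%:R - j%:R) <= 2 * (e / 3) * (b - a + dl i).
      rewrite -mulrA ler_wpM2l//; first by rewrite mulr_ge0// ltW.
      by lra.
    have e1 : 0 <= e * (b - a) by rewrite mulr_ge0 ?subr_ge0// ltW.
    have e2 : 0 <= e * dl i by rewrite mulr_ge0// ltW.
    move: dlN; rewrite /N mulrDr => dlN H1 H2; lra.
  move=> s; rewrite ltr_norml => /andP[s1 s2].
  have [st|/ltW st] := leP s t.
    rewrite ler0_norm ?subr_le0// -enormN.
    have -> : - (X s - X t - (s - t) *: F (X t)) = X t - X s - (t - s) *: F (X t).
      by rewrite !scalerBl; apply/rowP => q; rewrite !mxE; ring.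
    by rewrite opprB; apply: key => //; lra.
  by rewrite ger0_norm ?subr_ge0//; apply: key => //; lra.
have LX' a b : 0 <= a -> 0 <= b -> enorm (X b - X a) <= B * `|b - a|.
  move=> a0 b0; have [ab|/ltW ba] := leP a b; first by rewrite ger0_norm ?subr_ge0// LX.
  by rewrite distrC ger0_norm ?subr_ge0// enormB LX.
exists X; split.
  split=> //; apply/subspace_continuousP => s /=; rewrite in_itv /= andbT => s0.
  apply/cvg_enormP => e e0; rewrite near_withinE.
  apply/nbhs_ballP; exists (e / B) => [|u]; first by rewrite /= divr_gt0.
  rewrite -ball_normE /= distrC ltr_pdivlMr// mulrC => su.
  rewrite in_itv /= andbT => u0.
  exact: le_lt_trans (LX' _ _ s0 u0) su.
move=> T eta eta0.
(* Pointwise convergence becomes uniform through a finite grid of mesh [h]: the ultrafilter handles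
   the [N] grid points at once, and the Lipschitz bounds bridge the gaps. *)
have B10 : 0 < 8 * B by rewrite mulr_gt0.
pose h := eta / (8 * B).
have h0 : 0 < h by rewrite divr_gt0.
have hB : B * h = eta / 8 by rewrite /h; field; rewrite gt_eqF.
have eta40 : 0 < eta / 4 by rewrite divr_gt0.
pose N := (Num.truncn (T / h)).+1.
have Hgrid : \forall i \near U, forall q : 'I_N,
    enorm (x i (Num.truncn (h * q%:R / dl i)) - X (h * q%:R)) < eta / 4.
  apply: (@filter_forall _ _ (fun (q : 'I_N) i =>
    enorm (x i (Num.truncn (h * q%:R / dl i)) - X (h * q%:R)) < eta / 4) U _) => q.
  by apply: HX => //; rewrite mulr_ge0// ltW.
near=> i => k kT.
have dl0 : 0 < dl i by near: i; exact: dl_gt0.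
have dlh : dl i < h by near: i; exact: dl_cvg0.
have Hg : forall q : 'I_N,
    enorm (x i (Num.truncn (h * q%:R / dl i)) - X (h * q%:R)) < eta / 4.
  by near: i.
have Hlip : forall u v, 0 <= u -> u <= v -> v <= T ->
    enorm (x i (Num.truncn (v / dl i)) - x i (Num.truncn (u / dl i)))
      <= B * (v - u + dl i).
  by near: i; exact: HB.
set tau := dl i * k%:R in kT *.
have tau0 : 0 <= tau by rewrite mulr_ge0// ltW.
have tauE : Num.truncn (tau / dl i) = k.
  by rewrite /tau mulrAC mulfV ?mul1r ?natrK// gt_eqF.
have [q1 q2] := truncn_step h0 tau0.
have qN : (Num.truncn (tau / h) < N)%N.
  by rewrite ltnS; apply: le_truncn; rewrite ler_pM2r// invr_gt0.
have := Hg (Ordinal qN); rewrite /=; set q := Num.truncn (tau / h) in q1 q2 *.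
have hq0 : 0 <= h * q%:R by rewrite mulr_ge0// ltW.
have := Hlip _ _ hq0 q1 kT; rewrite tauE.
have := LX _ _ hq0 q1.
have Bt : B * (tau - h * q%:R) <= B * h by rewrite ler_wpM2l// ?(ltW B0)//; lra.
have Bd : B * dl i <= B * h by rewrite ler_wpM2l// ?(ltW B0)// ltW.
have := enorm_dist (x i k) (x i (Num.truncn (h * q%:R / dl i))) (X tau).
have := enorm_dist (x i (Num.truncn (h * q%:R / dl i))) (X (h * q%:R)) (X tau).
by rewrite [enorm (X (h * _) - X tau)]enormB mulrDr; lra.
Unshelve. all: by end_near.
Qed.

End UltraLimit.

(** * Uniqueness of the flow *)

Section CurveDerivatives.
Variables (R : realType) (d : nat).
Implicit Types (W : R -> 'rV[R]_d) (v : 'rV[R]_d).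

Lemma is_derive_coord W (t : R) v i : is_derive t 1 W v ->
  is_derive t 1 (fun s => W s 0 i) (v 0 i).
Proof.
move=> [dW <-]; split; first exact: (derivable_mxP W t 1).1 dW 0 i.
by rewrite derive_mx// mxE.
Qed.

Lemma is_derive_dotv W (t : R) v : is_derive t 1 W v ->
  is_derive t 1 (fun s => dotv (W s) (W s)) (2 * dotv (W t) v).
Proof.
move=> dW; have dWi i := is_derive_coord i dW.
have -> : (fun s => dotv (W s) (W s)) =
    \sum_(i < d) ((fun s => W s 0 i) * (fun s => W s 0 i)).
  by apply/funext => s; rewrite fct_sumE.
apply: is_derive_eq; rewrite mulr_sumr; apply: eq_bigr => i _.
by rewrite /GRing.scale /=; ring.
Qed.

Lemma is_derive_line (u v : 'rV[R]_d) (t : R) :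
  is_derive t 1 (fun s : R => s *: v + u) v.
Proof.
apply: is_derive_curve => e e0; exists 1 => // s _.
by rewrite opprD addrACA subrr addr0 -scalerBl subrr enorm0 mulr_ge0// ltW.
Qed.

End CurveDerivatives.

(** * Local estimates for the field and uniqueness of solutions *)

Section Uniqueness.
Variables (R : realType) (d n : nat) (f : 'rV[R]_d -> R) (xstar : 'rV[R]_d).
Hypothesis hC1 : times_continuously_differentiable 1 f.
Hypothesis hconv : convex_function setT f.
Hypothesis hmin : unique_minimizer f xstar.
Local Notation F := (rescaled_field n.+2 f).
Implicit Types (x y z : 'rV[R]_d).

Let df y : differentiable (f : _ -> R^o) y.
Proof. by have [H _] := hC1; exact: (H [::]). Qed.

Lemma nabla_bounded_on_ball k ws x r :
  times_continuously_differentiable k f -> (size ws <= k)%N ->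
  exists C, forall y, enorm (y - x) <= r -> `|nabla f ws y| <= C.
Proof.
move=> fk wsk; have cw := nabla_continuous fk wsk.
exact: (continuous_bounded_on (@closed_ball_compact _ _ x r) cw).
Qed.

(** Second derivatives are bounded on the ball, and the mean value theorem applies to each
    coordinate of the gradient along the segment, which stays in the ball. *)
Lemma grad_lipschitz k z r : (2 <= k)%N -> times_continuously_differentiable k f ->
  exists2 L, 0 <= L & forall x y, enorm (x - z) <= r -> enorm (y - z) <= r ->
    enorm (grad f x - grad f y) <= L * enorm (x - y).
Proof.
move=> k2 fk; have [dk _] := fk.
have : forall i : 'I_d, exists C, 0 <= C /\ forall x v, enorm (x - z) <= r ->
    `|nabla f [:: v; delta_mx 0 i] x| <= C * enorm v.
  move=> i; have [|C C0 HC] := nabla_bound (A := [set x | enorm (x - z) <= r]) dk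
    (fun ws => nabla_bounded_on_ball z r fk) (m := 1) (ws := [:: delta_mx 0 i]).
    exact: k2.
  exists C; split => // x v xr.
  by have := HC x [:: v] (enorm v) xr erefl; rewrite expr1; apply => u;
    rewrite inE => /eqP ->.
move=> /choice[C HC]; exists (\sum_i C i).
  by apply: sumr_ge0 => i _; have [] := HC i.
move=> x y xr yr; rewrite (le_trans (enorm_le_sum _))// mulr_suml.
apply: ler_sum => i _; have [C0 {}HC] := HC i.
rewrite !mxE; set g := nabla f [:: delta_mx 0 i].
have dg u : differentiable (g : _ -> R^o) u by apply: dk.
pose l := fun s : R => s *: (x - y) + y.
have dl (s : R) : is_derive s 1 (g \o l) ('D_(x - y) (g : _ -> R^o) (l s)).
  rewrite derive_dotv_grad//.
  by apply: is_derive_comp_curve; [exact: dg|exact: is_derive_line].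
have cl : {within `[0, 1], continuous (g \o l)}.
  by apply: derivable_within_continuous => s _; have [] := dl s.
have [s] := MVT ltr01 (fun s _ => dl s) cl.
rewrite in_itv /= => /andP[s0 s1].
rewrite /l /= scale1r subrK scale0r add0r subr0 mulr1 => ->.
apply: HC; have -> : s *: (x - y) + y - z = s *: (x - z) + (1 - s) *: (y - z).
  by apply/rowP => j; rewrite !mxE; ring.
have s1' : 0 <= 1 - s by rewrite subr_ge0 ltW.
rewrite (le_trans (enormD _ _))// !enormZ (ger0_norm s1') (ger0_norm (ltW s0)).
have := ler_wpM2l (ltW s0) xr; have := ler_wpM2l s1' yr; lra.
Qed.

(** Twice the right side equals [(enorm x ^+ n + enorm y ^+ n) * enorm (x - y) ^+ 2] plus the
    nonnegative product in [H]. *)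
Lemma power_map_coercive (c : R) x y : 0 <= c -> c <= enorm x -> c <= enorm y ->
  c ^+ n * enorm (x - y) ^+ 2 <= dotv (enorm x ^+ n *: x - enorm y ^+ n *: y) (x - y).
Proof.
move=> c0 cx cy.
have Px : c ^+ n <= enorm x ^+ n by rewrite lerXn2r ?nnegrE ?enorm_ge0.
have Py : c ^+ n <= enorm y ^+ n by rewrite lerXn2r ?nnegrE ?enorm_ge0.
have H : 0 <= (enorm x ^+ n - enorm y ^+ n) * (enorm x ^+ 2 - enorm y ^+ 2).
  have [xy|/ltW yx] := leP (enorm x) (enorm y).
    by rewrite mulr_le0// subr_le0 lerXn2r ?nnegrE ?enorm_ge0.
  by rewrite mulr_ge0// subr_ge0 lerXn2r ?nnegrE ?enorm_ge0.
have H2 : 0 <= (enorm x ^+ n + enorm y ^+ n - 2 * c ^+ n) * enorm (x - y) ^+ 2.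
  by rewrite mulr_ge0 ?sqr_ge0//; lra.
move: H H2; rewrite !sqr_enorm !dotvBl !dotvBr !dotvZl (dotvC y x).
lra.
Qed.

(** Near [z] the norm of [h] stays above half of [enorm (h z)], so coercivity holds with a fixed [c]
    and improves the Hölder bound to a Lipschitz one. *)
Lemma power_map_root_lipschitz (h g : 'rV[R]_d -> 'rV[R]_d) z (L : R) : 0 <= L ->
  (forall x y, enorm (x - z) <= 1 -> enorm (y - z) <= 1 ->
    enorm (g x - g y) <= L * enorm (x - y)) ->
  (forall x, enorm (h x) ^+ n *: h x = - g x) ->
  h @ z --> h z -> h z != 0 ->
  exists L' rho, [/\ 0 <= L', 0 < rho & forall x y, enorm (x - z) < rho ->
    enorm (y - z) < rho -> enorm (h x - h y) <= L' * enorm (x - y)].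
Proof.
move=> L0 HL hg /cvg_at_enormP hc hz.
have [c c0 cz] : exists2 c, 0 < c & enorm (h z) = 2 * c.
  by exists (enorm (h z) / 2); [rewrite divr_gt0// enorm_gt0|field].
have /enorm_near[rho rho0 Hrho] := hc _ c0.
have cn : 0 < c ^+ n by rewrite exprn_gt0.
have ch x : enorm (x - z) < rho -> c <= enorm (h x).
  move=> /Hrho H; have := enorm_subl (h z) (h z - h x).
  by rewrite subKr [enorm (h z - h x)]enormB cz; lra.
exists (L / c ^+ n), (Num.min 1 rho); split.
- by rewrite divr_ge0// ltW.
- by rewrite lt_min ltr01.
move=> x y; rewrite !lt_min => /andP[x1 xr] /andP[y1 yr].
have H := power_map_coercive (ltW c0) (ch _ xr) (ch _ yr).
rewrite !hg -opprD in H; have {}H := le_trans H (dotv_le _ _).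
rewrite enormN in H.
have Hg := HL _ _ (ltW x1) (ltW y1).
have [->|w0] := eqVneq (enorm (h x - h y)) 0.
  by rewrite mulr_ge0 ?enorm_ge0// divr_ge0// ltW.
have {}w0 : 0 < enorm (h x - h y) by rewrite lt_def w0 enorm_ge0.
move: H; rewrite expr2 mulrA ler_pM2r// => H.
by rewrite mulrAC ler_pdivlMr// mulrC (le_trans H).
Qed.

Lemma field_one_sided_lipschitz z :
  times_continuously_differentiable n.+1 f -> grad f z != 0 ->
  exists L rho, [/\ 0 <= L, 0 < rho & forall x y, enorm (x - z) < rho ->
    enorm (y - z) < rho -> dotv (x - y) (F x - F y) <= L * enorm (x - y) ^+ 2].
Proof.
move=> fn gz; have [n0|n0] := posnP n.
  exists 0, 1; split => // x y _ _; rewrite mul0r.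
  have E u : F u = - grad f u.
    have [_] := enorm_rescaled_field n f u.
    have -> : enorm (F u) ^+ n = 1 by rewrite [X in _ ^+ X]n0.
    by rewrite scale1r.
  rewrite !E -opprD dotvNr oppr_le0 dotvC.
  exact: grad_monotone.
have n1 : (2 <= n.+1)%N by rewrite ltnS.
have [L0 L00 HL0] := grad_lipschitz z 1 n1 fn.
have Fc : F @ z --> F z.
  exact: (@continuous_rescaled_field _ _ n _ (continuous_grad hC1) z).
have Fz : F z != 0 by rewrite rescaled_field_eq0.
have [L [rho [L'0 rho0 H]]] := power_map_root_lipschitz L00 HL0
  (fun x => (enorm_rescaled_field n f x).2) Fc Fz.
exists L, rho; split => // x y xz yz.
rewrite (le_trans (dotv_le _ _))// expr2 mulrA [leRHS]mulrC ler_wpM2l ?enorm_ge0//.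
exact: H.
Qed.

Lemma flow_cvg x0 X (t e : R) : rescaled_gradient_flow n.+2 f x0 X ->
  0 <= t -> 0 < e ->
  exists2 h, 0 < h & forall u, 0 <= u -> `|u - t| < h -> enorm (X u - X t) < e.
Proof.
move=> [_ /subspace_continuousP cX _] t0 e0.
have t0' : `[0, +oo[%classic t by rewrite /= in_itv /= t0.
have Xt := (cvg_enormP _ _).1 (cX t t0') e e0.
rewrite near_withinE in Xt; have [h /= h0 H] := (nbhs_ballP _ _).1 (Xt _).
exists h => // u u0 ut; apply: H; last by rewrite /= in_itv /= u0.
by rewrite -ball_normE /= distrC.
Qed.

Lemma flow_unique x0 X Y : times_continuously_differentiable n.+1 f ->
  rescaled_gradient_flow n.+2 f x0 X -> rescaled_gradient_flow n.+2 f x0 Y ->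
  forall t : R, 0 <= t -> X t = Y t.
Proof.
move=> fn hX hY t1 t10; apply/eqP/negPn/negP => /eqP XY1.
have [X0 cX dX] := hX; have [Y0 cY dY] := hY.
(* The supremum [t0] of [S] is the last meeting time before [t1]; the curves are not claimed to
   agree at all earlier times. *)
pose S := [set t : R | 0 <= t <= t1 /\ X t = Y t].
have S0 : S 0 by rewrite /S /= lexx t10 X0 Y0.
have supS : has_sup S.
  by split; [exists 0|exists t1 => s [/andP[_ ?] _]].
pose t0 := sup S.
have t00 : 0 <= t0 by exact: (ub_le_sup supS.2 S0).
have t01 : t0 <= t1 by apply: sup_le_ub; [exists 0|move=> s [/andP[_ ?] _]].
have XY0 : X t0 = Y t0.
  apply/eqP; rewrite -subr_eq0 -enorm_eq0 eq_le enorm_ge0 andbT.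
  apply/ler_addgt0Pr => e e0; rewrite add0r.
  have e20 : 0 < e / 2 by rewrite divr_gt0.
  have [h h0 Hh] := flow_cvg hX t00 e20; have [l l0 Hl] := flow_cvg hY t00 e20.
  have hl0 : 0 < Num.min h l by rewrite lt_min h0.
  have [s Ss] := sup_adherent hl0 supS; rewrite -/t0 => st.
  have st0 : s <= t0 := ub_le_sup supS.2 Ss.
  have [/andP[s0 _] XYs] := Ss.
  have sth : `|s - t0| < Num.min h l.
    by rewrite distrC ger0_norm ?subr_ge0//; lra.
  move: sth; rewrite lt_min => /andP[/(Hh _ s0) H1 /(Hl _ s0) H2].
  have := enorm_dist (X t0) (X s) (Y t0).
  by rewrite [enorm (X t0 - X s)]enormB {2}XYs; lra.
have W0 t : t0 < t -> t <= t1 -> X t <> Y t.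
  move=> tt0 tt1 XYt; have : t <= t0.
    by apply: (ub_le_sup supS.2); rewrite /S /= tt1 (le_trans t00 (ltW tt0)).
  by rewrite leNgt tt0.
have t0t1 : t0 < t1.
  by rewrite lt_neqAle t01 andbT; apply/eqP => t01E; apply: XY1; rewrite -t01E.
(* Had the curves met at the minimizer, energy decrease would keep both there, and they would agree
   at [t1]. *)
have gz : grad f (X t0) != 0.
  apply/eqP => /(grad_eq0 df hconv hmin) zE; apply: XY1.
  have HX : f (X t1) <= f (X t0) := flow_value_nincr df hX t00 t01.
  have HY : f (Y t1) <= f (Y t0) := flow_value_nincr df hY t00 t01.
  rewrite -XY0 zE in HY; rewrite zE in HX.
  by rewrite (le_minimizer hmin HX) (le_minimizer hmin HY).
have [L [rho [L0 rho0 HL]]] := field_one_sided_lipschitz fn gz.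
have [h h0 Hh] := flow_cvg hX t00 rho0; have [l l0 Hl] := flow_cvg hY t00 rho0.
(* During time [T] both curves stay in the [rho]-ball and before [t1], and [4 * L * T <= 1]. *)
pose T := Num.min (Num.min (h / 2) (l / 2)) (Num.min (t1 - t0) (4 * (L + 1))^-1).
have T0 : 0 < T.
  by rewrite !lt_min !divr_gt0// subr_gt0 t0t1 invr_gt0 mulr_gt0// ltr_wpDl.
have Th : T < h.
  by rewrite (@le_lt_trans _ _ (h / 2))//; [rewrite !ge_min lexx|lra].
have Tl : T < l.
  by rewrite (@le_lt_trans _ _ (l / 2))//; [rewrite !ge_min lexx orbT|lra].
have Tt1 : t0 + T <= t1.
  by rewrite -lerBrDl !ge_min lexx orbT.
have TL : 4 * (L * T) <= 1.
  have : T <= (4 * (L + 1))^-1 by rewrite !ge_min lexx !orbT.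
  rewrite -[X in _ <= X]mul1r ler_pdivlMr; last by rewrite mulr_gt0// ltr_wpDl.
  by have := mulr_ge0 L0 (ltW T0); lra.
pose phi := fun s : R => dotv (X s - Y s) (X s - Y s).
have dphi (s : R) : 0 < s -> is_derive s 1 phi (2 * dotv (X s - Y s) (F (X s) - F (Y s))).
  by move=> s0; apply: (@is_derive_dotv _ _ (fun s => X s - Y s));
    apply: is_deriveB; [exact: dX|exact: dY].
have phi_lt (s : R) : t0 <= s -> s <= t0 + T ->
    2 * dotv (X s - Y s) (F (X s) - F (Y s)) <= 2 * L * phi s.
  move=> s1 s2; have s0 := le_trans t00 s1.
  have sT : `|s - t0| <= T by rewrite ger0_norm ?subr_ge0//; lra.
  rewrite -mulrA ler_pM2l// /phi -sqr_enorm; apply: HL.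
    by apply: Hh => //; exact: le_lt_trans Th.
  by rewrite XY0; apply: Hl => //; exact: le_lt_trans Tl.
have cphi : {within `[0, +oo[, continuous phi}.
  move: cX cY => /subspace_continuousP cX /subspace_continuousP cY.
  apply/subspace_continuousP => s s0.
  have -> : phi = (fun u : 'rV[R]_d => enorm u * enorm u) \o (fun s => X s - Y s).
    by apply/funext => u; rewrite /= -expr2 sqr_enorm.
  apply: (@cvg_comp _ _ _ (fun s => X s - Y s) (fun u : 'rV[R]_d => enorm u * enorm u)
    _ (nbhs (X s - Y s))); first by apply: cvgB; [exact: cX|exact: cY].
  by apply: cvgM; exact: enorm_continuous.
have phit0 : phi t0 = 0 by rewrite /phi XY0 subrr dotv0l.
have tT : t0 <= t0 + T by rewrite lerDl ltW.
have cphi' a b : 0 <= a -> {within `[a, b], continuous phi}.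
  move=> a0; apply: continuous_subspaceW cphi => s /=.
  by rewrite !in_itv /= andbT => /andP[as_ _]; exact: le_trans as_.
(* In place of Gronwall: at a maximum point [c] of [phi], the mean value theorem gives
   [phi c <= 2 * L * T * phi c <= phi c / 2], hence [phi c = 0]. *)
have [c] := EVT_max tT (cphi' _ _ t00).
rewrite in_itv /= => /andP[c0 cT] Hc.
have phi0 s : 0 <= phi s by exact: dotvv_ge0.
suff phic : phi c <= 0.
  have : phi (t0 + T) <= phi c by apply: Hc; rewrite in_itv /= tT lexx.
  move=> /le_trans/(_ phic) phiT.
  apply: (W0 (t0 + T)) => //; first by rewrite ltrDl.
  apply/eqP; rewrite -subr_eq0; apply/eqP/dotvv_eq0/eqP.
  by rewrite eq_le phiT dotvv_ge0.
have [c0'|c0'] := eqVneq c t0; first by rewrite c0' phit0.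
have {c0'}c0' : t0 < c by rewrite lt_neqAle eq_sym c0'.
have dphi' s : s \in `]t0, c[ ->
    is_derive s 1 phi (2 * dotv (X s - Y s) (F (X s) - F (Y s))).
  by rewrite in_itv /= => /andP[s0 _]; apply: dphi; exact: le_lt_trans s0.
have [s] := MVT c0' dphi' (cphi' _ _ t00).
rewrite in_itv /= => /andP[s0 sc]; rewrite phit0 subr0 => E.
have s0' := ltW s0.
have sT : s <= t0 + T by rewrite (le_trans (ltW sc)).
have H1 := phi_lt s s0' sT.
have H2 : phi s <= phi c by apply: Hc; rewrite in_itv /= s0' sT.
have ct0 : 0 <= c - t0 by rewrite subr_ge0.
have cT' : c - t0 <= T by lra.
have H3 : phi c <= 2 * L * phi c * T.
  rewrite {1}E; apply: (@le_trans _ _ (2 * L * phi s * (c - t0))).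
    by rewrite ler_wpM2r.
  rewrite ler_pM// ?mulr_ge0//; last by rewrite ler_wpM2l ?mulr_ge0.
by have := ler_wpM2r (phi0 c) TL; have := phi0 c; lra.
Qed.

End Uniqueness.

(** * Continuous-time limit *)

Section ContinuousTimeLimit.
Variables (R : realType) (d n : nat) (f : 'rV[R]_d -> R) (xstar : 'rV[R]_d).
Hypothesis hC1 : times_continuously_differentiable 1 f.
Hypothesis hconv : convex_function setT f.
Hypothesis hmin : unique_minimizer f xstar.
Variable x0 : 'rV[R]_d.
Local Notation F := (rescaled_field n.+2 f).
Local Notation dl := (@time_step R n.+2).

Lemma time_step_near (e : R) : 0 < e ->
  \forall eps \near (0 : R)^'+, 0 < dl eps /\ dl eps < e.
Proof.
move=> e0; have /cvgrPdist_lt/(_ _ e0) := @cvg_time_step R n.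
move=> H; near=> eps.
have eps0 : 0 < eps by near: eps; exact: nbhs_right_gt.
have := time_step_gt0 n eps0; split => //.
rewrite -[dl eps]gtr0_norm// -normrN -sub0r.
by near: eps.
Unshelve. all: by end_near.
Qed.

Lemma flow_exists : exists X, rescaled_gradient_flow n.+2 f x0 X.
Proof.
have [U [UU sU]] := ultraFilterLemma (at_right_proper_filter (0 : R)).
(* Explicit Euler steps, whose consistency error is zero. *)
pose x (eps : R) k := iter k (fun y => y + dl eps *: F y) x0.
have [||||X [hX _]] := @ultra_limit_flow R d n f xstar hC1 hconv hmin R U dl x x0 UU.
- by apply: sU; apply: filterS (time_step_near ltr01) => eps [].
- by move=> e e0; apply: sU; apply: filterS (time_step_near e0) => eps [].
- by [].
- move=> r eta eta0; apply: sU; apply: filterS (time_step_near ltr01) => eps [dl0 _] k _.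
  by rewrite /x iterS addrAC addrK subrr enorm0 mulr_ge0// ltW.
by exists X.
Qed.

(** If [P] failed to hold eventually, some ultrafilter finer than [eps -> 0+] would contain its
    complement. The limit along it is a flow from [x0], equal to [X] by uniqueness, so the
    ultrafilter would also contain [P]. *)
Lemma flow_is_limit X : times_continuously_differentiable n.+1 f ->
  rescaled_gradient_flow n.+2 f x0 X -> continuous_time_limit n.+2 f x0 X.
Proof.
move=> fn hX x hx T eta eta0.
set P := (X in \forall eps \near _, X eps).
apply: contrapT => nP.
have PG : ProperFilter (within (~` P) (0 : R)^'+).
  apply: Build_ProperFilter => H; apply: nP.
  by apply: (@filterS _ (0 : R)^'+ _ _ _ _ H) => eps {}H; apply: contrapT.
have [U [UU sU]] := ultraFilterLemma PG.
have sU' A : (0 : R)^'+ A -> U A.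
  by move=> HA; apply: sU; apply: filterS HA => eps.
(* Runs are given only for positive [eps]; elsewhere the constant [x0] keeps the initial condition
   valid at every index. *)
pose x' (eps : R) k := if 0 < eps then x eps k else x0.
have [||||Y [hY HY]] := @ultra_limit_flow R d n f xstar hC1 hconv hmin R U dl x' x0 UU.
- by apply: sU'; apply: filterS (time_step_near ltr01) => eps [].
- by move=> e e0; apply: sU'; apply: filterS (time_step_near e0) => eps [].
- by move=> eps; rewrite /x'; case: ifP => // /hx[].
- move=> r e e0; apply: sU'.
  have H := gradient_update_consistent fn.1
    (fun ws => nabla_bounded_on_ball xstar r fn) e0.
  near=> eps => k.
  have eps0 : 0 < eps by near: eps; exact: nbhs_right_gt.
  rewrite /x' eps0 => xr; have [_ hk] := hx _ eps0.
  by move: (x eps k) (x eps k.+1) xr (hk k); near: eps; exact: H.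
have UP : U P.
  have H0 : U [set eps | 0 < eps /\ 0 < dl eps].
    apply: sU'; near=> eps; split; first by near: eps; exact: nbhs_right_gt.
    by near: eps; apply: filterS (time_step_near ltr01) => eps [].
  apply: filterS (filterI H0 (HY T eta eta0)) => eps [[eps0 dl0] H] k kT.
  have := H k kT; rewrite /x' eps0.
  by rewrite -(flow_unique hC1 hconv hmin fn hX hY)// mulr_ge0// ltW.
have UnP : U (~` P) by apply: sU; exact: withinT.
have [eps []] := filter_ex (filterI UP UnP).
by [].
Unshelve. all: by end_near.
Qed.

End ContinuousTimeLimit.

Theorem theorem3p4 (R : realType) (d p : nat) (f : 'rV[R]_d -> R)
    (xstar : 'rV[R]_d)
    (hp : (2 <= p)%N)
    (hC1 : times_continuously_differentiable 1 f)
    (hconv : convex_function setT f)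
    (hmin : unique_minimizer f xstar) :
  [/\ (* the velocity (x_{k+1} - x_k) / delta of the algorithm at any point *)
      times_differentiable (p - 1) f ->
      forall (x : 'rV[R]_d) (y : R -> 'rV[R]_d),
        (forall eps, 0 < eps -> gradient_update p eps f x (y eps)) ->
        (time_step p eps)^-1 *: (y eps - x) @[eps --> (0 : R)^'+]
          --> rescaled_field p f x,
      (* the curves traced by the algorithm *)
      times_continuously_differentiable (p - 1) f ->
      forall x0 : 'rV[R]_d,
        (exists X : R -> 'rV[R]_d, rescaled_gradient_flow p f x0 X) /\
        (forall X : R -> 'rV[R]_d, rescaled_gradient_flow p f x0 X ->
           continuous_time_limit p f x0 X)
    & (* the convergence rate *)
      forall (x0 : 'rV[R]_d) (X : R -> 'rV[R]_d),
        rescaled_gradient_flow p f x0 X ->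
        (forall t : R, 0 < t ->
           f (X t) - f xstar <=
             (p - 1)%:R ^+ (p - 1) * level_radius f xstar x0 ^+ p
               / t ^+ (p - 1)) /\
        (exists2 C : R, 0 < C & \forall t \near +oo,
           `|f (X t) - f xstar| <= C * `|(t ^+ (p - 1))^-1|)].
Proof.
case: p hp => [//|[//|n]] _; rewrite subn1 [n.+2.-1]/=.
have df x : differentiable (f : _ -> R^o) x by have [H _] := hC1; exact: (H [::]).
split=> [fn x y hy|fn x0|x0 X hX]; first exact: gradient_update_velocity.
  split; first exact: (flow_exists n hC1 hconv hmin).
  by move=> X; exact: (flow_is_limit hC1 hconv hmin).
have rate (t : R) : 0 < t -> f (X t) - f xstar <=
    n.+1%:R ^+ n.+1 * level_radius f xstar x0 ^+ n.+2 / t ^+ n.+1.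
  move=> t0; rewrite ler_pdivlMr ?exprn_gt0// mulrC.
  exact: (flow_rate df hconv hmin hX).
split=> //; set K := _ * _ in rate *.
have K0 : 0 <= K.
  rewrite mulr_ge0// exprn_ge0// (le_trans (enorm_ge0 (x0 - xstar)))//.
  exact: (le_level_radius df hconv hmin).
(* The summand 1 makes the constant positive when the level radius is 0. *)
exists (K + 1); first by rewrite ltr_wpDl.
near=> t.
have t0 : 0 < t by near: t; exact: nbhs_pinfty_gt.
have [m _] := hmin.
have ti0 : 0 <= (t ^+ n.+1)^-1 by rewrite invr_ge0 exprn_ge0// ltW.
have phi0 : 0 <= f (X t) - f xstar by rewrite subr_ge0.
rewrite (ger0_norm phi0) (ger0_norm ti0) (le_trans (rate t t0))// ler_wpM2r//.
by rewrite lerDl.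
Unshelve. all: by end_near.
Qed.
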